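(* Let $\kappa$ be a weakly compact cardinal such that $\kappa\to(\omega_1)^{<\omega}_{<\kappa}$. Then the first unfoldable cardinal is less than $\kappa$.
   Context: $\kappa\to(\omega_1)^{<\omega}_{<\kappa}$ means: for every $\gamma<\kappa$ and every $f:[\kappa]^{<\omega}\to\gamma$ there is $H\subset\kappa$ of order type $\omega_1$ such that for each $n<\omega$, $f$ is constant on $[H]^n$. $\mathcal{R}(\kappa)=V_\kappa$ is the set of all sets of rank less than $\kappa$. For structures $\mathfrak{A}=(M,E,\dots)$ and $\mathfrak{B}=(N,F,\dots)$ in the same language, $\mathfrak{B}$ is an end elementary extension (eee) of $\mathfrak{A}$, written $\mathfrak{A}\prec_e\mathfrak{B}$, if $\mathfrak{B}$ is a proper elementary extension of $\mathfrak{A}$ and for every $a\in M$, $\{b\in M : bEa\}=\{b\in N: bFa\}$. $o(M)$ denotes the ordinal height of $M$. A cardinal $\kappa$ is unfoldable if it is inaccessible and for every ordinal $\alpha$ and every $S\subset\mathcal{R}(\kappa)$ there is a well-founded eee $M$ of $(\mathcal{R}(\kappa),\in,S)$ with $o(M)\geq\alpha$. *)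

(* Defs.v *)
(* Set theory is developed in the cumulative hierarchy [V] of well-founded
   trees (Aczel), taken modulo bisimilarity so that equality in [V] is Leibniz
   equality.  [V] satisfies ZFC, with separation, replacement and choice for
   arbitrary Rocq predicates and functions.  A function between sets is
   therefore represented by a function [V -> V] of which only the values on
   the domain matter, and a relation on a set by a predicate on [V]. *)
From Stdlib Require Import ClassicalEpsilon FunctionalExtensionality
  PropExtensionality ProofIrrelevance List.

Inductive tree : Type := node (A : Type) (f : A -> tree).

Fixpoint teq (s t : tree) : Prop :=
  match s, t with
  | node A f, node B g =>
      (forall a, exists b, teq (f a) (g b)) /\
      (forall b, exists a, teq (f a) (g b))
  end.

Lemma teq_refl s : teq s s.
Proof. induction s as [A f IH]; split; intros a; exists a; apply IH. Qed.

Lemma teq_sym s t : teq s t -> teq t s.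
Proof.
  revert t; induction s as [A f IH]; intros [B g] [H1 H2]; split.
  - intros b; destruct (H2 b) as [a Ha]; exists a; now apply IH.
  - intros a; destruct (H1 a) as [b Hb]; exists b; now apply IH.
Qed.

Lemma teq_trans s t u : teq s t -> teq t u -> teq s u.
Proof.
  revert t u; induction s as [A f IH]; intros [B g] [C h] [H1 H2] [K1 K2].
  split.
  - intros a; destruct (H1 a) as [b Hb]; destruct (K1 b) as [c Hc].
    exists c; now apply (IH a (g b)).
  - intros c; destruct (K2 c) as [b Hb]; destruct (H2 b) as [a Ha].
    exists a; now apply (IH a (g b)).
Qed.

Definition canon (t : tree) : tree := epsilon (inhabits t) (teq t).

Lemma canon_teq t : teq t (canon t).
Proof. unfold canon; apply epsilon_spec; exists t; apply teq_refl. Qed.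

Lemma canon_eq s t : teq s t -> canon s = canon t.
Proof.
  intros H; unfold canon.
  assert (E : teq s = teq t).
  { apply functional_extensionality; intros u; apply propositional_extensionality.
    split; intros K; [apply teq_trans with s | apply teq_trans with t]; auto.
    now apply teq_sym. }
  rewrite E; f_equal; apply proof_irrelevance.
Qed.

Definition V : Type := {t : tree | canon t = t}.

Definition cls (t : tree) : V :=
  exist _ (canon t) (canon_eq _ _ (teq_sym _ _ (canon_teq t))).

Definition repr (x : V) : tree := proj1_sig x.

Lemma cls_eq s t : cls s = cls t <-> teq s t.
Proof.
  split; intros H.
  - apply teq_trans with (canon s); [apply canon_teq|].
    apply (f_equal repr) in H; simpl in H; rewrite H.
    apply teq_sym, canon_teq.
  - apply eq_sig_hprop; [intros; apply proof_irrelevance|]; now apply canon_eq.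
Qed.

Lemma cls_repr x : cls (repr x) = x.
Proof.
  destruct x as [t Ht]; apply eq_sig_hprop;
    [intros; apply proof_irrelevance | exact Ht].
Qed.

Lemma teq_repr_cls t : teq (repr (cls t)) t.
Proof. apply teq_sym, canon_teq. Qed.

Definition index (x : V) : Type := match repr x with node A _ => A end.

Definition elem (x : V) : index x -> V :=
  match repr x as t return match t with node A _ => A end -> V with
  | node A f => fun a => cls (f a)
  end.

Definition mem (x y : V) : Prop := exists i : index y, elem y i = x.

Declare Scope V_scope.
Delimit Scope V_scope with V.
Open Scope V_scope.
Notation "x ∈ y" := (mem x y) (at level 70) : V_scope.
Notation "x ⊆ y" := (forall z, z ∈ x -> z ∈ y) (at level 70) : V_scope.

Lemma mem_repr x y :
  x ∈ y <-> match repr y with node A f => exists a, cls (f a) = x end.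
Proof.
  unfold mem, index, elem; destruct (repr y); reflexivity.
Qed.

Lemma mem_cls x A f : x ∈ cls (node A f) <-> exists a, cls (f a) = x.
Proof.
  rewrite mem_repr.
  assert (H := teq_repr_cls (node A f)).
  destruct (repr (cls (node A f))) as [B g]; destruct H as [H1 H2].
  split; intros [a <-].
  - destruct (H1 a) as [b Hb]; exists b; apply cls_eq; now apply teq_sym.
  - destruct (H2 a) as [b Hb]; exists b; now apply cls_eq.
Qed.

Lemma V_ext x y : (forall z, z ∈ x <-> z ∈ y) -> x = y.
Proof.
  intros H; rewrite <- (cls_repr x), <- (cls_repr y); apply cls_eq.
  assert (K : forall z, match repr x with node A f => exists a, cls (f a) = z end
    <-> match repr y with node B g => exists b, cls (g b) = z end).
  { intros z; rewrite <- !mem_repr; apply H. }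
  destruct (repr x) as [A f], (repr y) as [B g]; split.
  - intros a; destruct (proj1 (K _) (ex_intro _ a eq_refl)) as [b Hb].
    exists b; apply cls_eq; now symmetry.
  - intros b; destruct (proj2 (K _) (ex_intro _ b eq_refl)) as [a Ha].
    exists a; now apply cls_eq.
Qed.

Lemma mem_wf : well_founded mem.
Proof.
  assert (H : forall t, Acc mem (cls t)).
  { induction t as [A f IH]; constructor; intros y Hy.
    apply mem_cls in Hy; destruct Hy as [a <-]; apply IH. }
  intros x; rewrite <- (cls_repr x); apply H.
Qed.

Definition set_of (A : Type) (F : A -> V) : V :=
  cls (node A (fun a => repr (F a))).

Lemma mem_set_of x A (F : A -> V) : x ∈ set_of A F <-> exists a, F a = x.
Proof.
  unfold set_of; rewrite mem_cls; split; intros [a Ha]; exists a;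
    [rewrite <- Ha | rewrite <- Ha]; now rewrite cls_repr.
Qed.

Definition empty : V := set_of Empty_set (fun e => match e with end).

Definition bigcup (A : Type) (F : A -> V) : V :=
  set_of {a : A & index (F a)} (fun p => elem (F (projT1 p)) (projT2 p)).

Definition power (x : V) : V :=
  set_of (index x -> Prop)
    (fun P => set_of {i : index x | P i} (fun i => elem x (proj1_sig i))).

Definition succ (x : V) : V :=
  set_of (option (index x))
    (fun o => match o with Some i => elem x i | None => x end).

Fixpoint numeral (n : nat) : V :=
  match n with O => empty | S m => succ (numeral m) end.

Definition omega : V := set_of nat numeral.

Lemma mem_bigcup x A (F : A -> V) : x ∈ bigcup A F <-> exists a, x ∈ F a.
Proof.
  unfold bigcup; rewrite mem_set_of; split.
  - intros [[a i] <-]; exists a, i; reflexivity.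
  - intros [a [i <-]]; now exists (existT _ a i).
Qed.

Lemma mem_power x y : y ∈ power x <-> y ⊆ x.
Proof.
  unfold power; rewrite mem_set_of; split.
  - intros [P <-] z Hz; rewrite mem_set_of in Hz; destruct Hz as [[i Hi] <-].
    now exists i.
  - intros H; exists (fun i => elem x i ∈ y); apply V_ext; intros z.
    rewrite mem_set_of; split.
    + intros [[i Hi] <-]; exact Hi.
    + intros Hz; destruct (H z Hz) as [i <-].
      now exists (exist (fun i => elem x i ∈ y) i Hz).
Qed.

Lemma mem_succ x y : y ∈ succ x <-> y ∈ x \/ y = x.
Proof.
  unfold succ; rewrite mem_set_of; split.
  - intros [[i|] <-]; [left; now exists i | now right].
  - intros [[i <-] | ->]; [now exists (Some i) | now exists None].
Qed.

Definition transitive (x : V) : Prop := forall y, y ∈ x -> y ⊆ x.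

(* By foundation ([mem_wf]) a linear order given by membership is a well-order. *)
Definition ordinal (a : V) : Prop :=
  transitive a /\ forall x y, x ∈ a -> y ∈ a -> x ∈ y \/ x = y \/ y ∈ x.

Fixpoint tree_rank (t : tree) : V :=
  match t with node A f => bigcup A (fun a => succ (tree_rank (f a))) end.

Definition rank (x : V) : V := tree_rank (repr x).

Fixpoint tree_R (t : tree) : V :=
  match t with node A f => bigcup A (fun a => power (tree_R (f a))) end.

Definition R (a : V) : V := tree_R (repr a).

Lemma tree_rank_teq s t : teq s t -> tree_rank s = tree_rank t.
Proof.
  revert t; induction s as [A f IH]; intros [B g] [H1 H2]; simpl.
  apply V_ext; intros z; rewrite !mem_bigcup; split.
  - intros [a Ha]; destruct (H1 a) as [b Hb]; exists b.
    now rewrite <- (IH a _ Hb).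
  - intros [b Hb]; destruct (H2 b) as [a Ha]; exists a.
    now rewrite (IH a _ Ha).
Qed.

Lemma tree_R_teq s t : teq s t -> tree_R s = tree_R t.
Proof.
  revert t; induction s as [A f IH]; intros [B g] [H1 H2]; simpl.
  apply V_ext; intros z; rewrite !mem_bigcup; split.
  - intros [a Ha]; destruct (H1 a) as [b Hb]; exists b.
    now rewrite <- (IH a _ Hb).
  - intros [b Hb]; destruct (H2 b) as [a Ha]; exists a.
    now rewrite (IH a _ Ha).
Qed.

Lemma mem_rank x z :
  z ∈ rank x <-> exists y, y ∈ x /\ (z ∈ rank y \/ z = rank y).
Proof.
  assert (K := fun y => mem_repr y x); unfold rank at 1.
  destruct (repr x) as [A f]; simpl; rewrite mem_bigcup.
  assert (E : forall a, rank (cls (f a)) = tree_rank (f a))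
    by (intros a; apply tree_rank_teq, teq_repr_cls).
  split.
  - intros [a Ha]; exists (cls (f a)); split; [apply K; now exists a|].
    now rewrite E, <- mem_succ.
  - intros [y [Hy Hz]]; apply K in Hy; destruct Hy as [a <-].
    exists a; now rewrite mem_succ, <- E.
Qed.

Lemma mem_R a x : x ∈ R a <-> exists b, b ∈ a /\ x ⊆ R b.
Proof.
  assert (K := fun y => mem_repr y a); unfold R at 1.
  destruct (repr a) as [A f]; simpl; rewrite mem_bigcup.
  assert (E : forall i, R (cls (f i)) = tree_R (f i))
    by (intros i; apply tree_R_teq, teq_repr_cls).
  split.
  - intros [i Hi]; exists (cls (f i)); split; [apply K; now exists i|].
    now rewrite E, <- mem_power.
  - intros [b [Hb Hx]]; apply K in Hb; destruct Hb as [i <-].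
    exists i; now rewrite mem_power, <- E.
Qed.

Lemma ordinal_mem a b : ordinal a -> b ∈ a -> ordinal b.
Proof.
  intros [Ta La] Hb; split.
  - intros y Hy z Hz.
    assert (Hya : y ∈ a) by exact (Ta b Hb y Hy).
    assert (Hza : z ∈ a) by exact (Ta y Hya z Hz).
    destruct (La z b Hza Hb) as [H|[->|H]]; [exact H| |].
    + exfalso; clear -Hy Hz.
      assert (W := mem_wf y); revert b Hy Hz; induction W as [y _ IH].
      intros b Hy Hz; exact (IH b Hz y Hz Hy).
    + exfalso; clear -Hy Hz H.
      assert (W := mem_wf y); revert b z Hy Hz H; induction W as [y _ IH].
      intros b z Hy Hz H; exact (IH z Hz y b Hz H Hy).
  - intros x y Hx Hy; apply La; eapply Ta; eauto.
Qed.

Lemma rank_ordinal x : ordinal (rank x).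
Proof.
  induction (mem_wf x) as [x _ IH]; split.
  - intros u Hu v Hv; apply mem_rank in Hu; destruct Hu as [y [Hy Hu]].
    apply mem_rank; exists y; split; [exact Hy|]; left.
    destruct Hu as [Hu | ->]; [|exact Hv].
    exact (proj1 (IH y Hy) u Hu v Hv).
  - assert (O : forall u, u ∈ rank x -> ordinal u).
    { intros u Hu; apply mem_rank in Hu; destruct Hu as [y [Hy [Hu | ->]]].
      - now apply ordinal_mem with (rank y); [apply IH|].
      - now apply IH. }
    intros u v Hu Hv; apply O in Hu; apply O in Hv; clear -Hu Hv.
    revert v Hu Hv; induction (mem_wf u) as [u _ IHu]; intros v Hu.
    induction (mem_wf v) as [v _ IHv]; intros Hv.
    destruct (classic (v ∈ u)) as [H|Nvu]; [now right; right|].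
    destruct (classic (u ∈ v)) as [H|Nuv]; [now left|].
    right; left; apply V_ext; intros z; split; intros Hz.
    + destruct (IHu z Hz v (ordinal_mem _ _ Hu Hz) Hv) as [H|[->|H]].
      * exact H.
      * contradiction.
      * exfalso; apply Nvu; exact (proj1 Hu z Hz v H).
    + destruct (IHv z Hz (ordinal_mem _ _ Hv Hz)) as [H|[->|H]].
      * exfalso; apply Nuv; exact (proj1 Hv z Hz u H).
      * contradiction.
      * exact H.
Qed.

Lemma ordinal_tricho u v : ordinal u -> ordinal v -> u ∈ v \/ u = v \/ v ∈ u.
Proof.
  assert (E : forall a, ordinal a -> rank a = a).
  { intros a; induction (mem_wf a) as [a _ IH]; intros Ha.
    apply V_ext; intros z; rewrite mem_rank; split.
    - intros [y [Hy H]]; rewrite (IH y Hy (ordinal_mem _ _ Ha Hy)) in H.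
      destruct H as [H| ->]; [exact (proj1 Ha y Hy z H) | exact Hy].
    - intros Hz; exists z; split; [exact Hz|]; right; symmetry.
      exact (IH z Hz (ordinal_mem _ _ Ha Hz)). }
  intros Hu Hv.
  apply (proj2 (rank_ordinal (set_of bool (fun b => if b then u else v))));
    apply mem_rank.
  - exists u; rewrite (E u Hu); split; [|now right].
    apply mem_set_of; now exists true.
  - exists v; rewrite (E v Hv); split; [|now right].
    apply mem_set_of; now exists false.
Qed.

Lemma mem_R_rank a x : ordinal a -> x ∈ R a <-> rank x ∈ a.
Proof.
  revert x; induction (mem_wf a) as [a _ IH]; intros x Ha; rewrite mem_R.
  split.
  - intros [b [Hb Hx]]; assert (Ob := ordinal_mem _ _ Ha Hb).
    assert (S : rank x ⊆ b).
    { intros z Hz; apply mem_rank in Hz; destruct Hz as [y [Hy Hz]].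
      apply Hx in Hy; apply (IH b Hb) in Hy; [|exact Ob].
      destruct Hz as [Hz | ->]; [exact (proj1 Ob _ Hy z Hz) | exact Hy]. }
    destruct (ordinal_tricho _ _ (rank_ordinal x) Ob) as [H|[->|H]].
    + exact (proj1 Ha b Hb _ H).
    + exact Hb.
    + exfalso; apply S in H; clear -H.
      induction (mem_wf b) as [b _ IH]; exact (IH b H H).
  - intros H; exists (rank x); split; [exact H|]; intros y Hy.
    apply (IH _ H); [exact (ordinal_mem _ _ Ha H)|].
    apply mem_rank; exists y; split; [exact Hy | now right].
Qed.

Definition injects (x y : V) : Prop :=
  exists f : V -> V, (forall a, a ∈ x -> f a ∈ y) /\
    (forall a b, a ∈ x -> b ∈ x -> f a = f b -> a = b).

Definition equinumerous (x y : V) : Prop :=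
  exists f : V -> V, (forall a, a ∈ x -> f a ∈ y) /\
    (forall a b, a ∈ x -> b ∈ x -> f a = f b -> a = b) /\
    (forall c, c ∈ y -> exists a, a ∈ x /\ f a = c).

Definition cardinal (k : V) : Prop :=
  ordinal k /\ forall a, a ∈ k -> ~ equinumerous a k.

Definition uncountable_cardinal (k : V) : Prop := cardinal k /\ omega ∈ k.

Definition regular (k : V) : Prop :=
  forall (a : V) (f : V -> V), a ∈ k -> (forall x, x ∈ a -> f x ∈ k) ->
    exists b, b ∈ k /\ forall x, x ∈ a -> f x ∈ b.

Definition strong_limit (k : V) : Prop :=
  forall a, a ∈ k -> exists b, b ∈ k /\ equinumerous (power a) b.

Definition inaccessible (k : V) : Prop :=
  uncountable_cardinal k /\ regular k /\ strong_limit k.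

Definition is_omega1 (w : V) : Prop :=
  ordinal w /\ ~ injects w omega /\ forall a, a ∈ w -> injects a omega.

Definition has_size (n : nat) (x : V) : Prop :=
  exists s : list V, NoDup s /\ length s = n /\ forall y, y ∈ x <-> In y s.

(* [y] belongs to [x]^n. *)
Definition subset_of_size (n : nat) (x y : V) : Prop := y ⊆ x /\ has_size n y.

Definition has_order_type (H a : V) : Prop :=
  exists g : V -> V, (forall x, x ∈ a -> g x ∈ H) /\
    (forall x y, x ∈ a -> y ∈ a -> x ∈ y -> g x ∈ g y) /\
    (forall h, h ∈ H -> exists x, x ∈ a /\ g x = h).

Definition homogeneous (f : V -> V) (n : nat) (H : V) : Prop :=
  forall x y, subset_of_size n H x -> subset_of_size n H y -> f x = f y.

(* k -> (a)^n_c *)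
Definition arrow (k a : V) (n : nat) (c : V) : Prop :=
  forall f : V -> V, (forall x, subset_of_size n k x -> f x ∈ c) ->
    exists H, H ⊆ k /\ has_order_type H a /\ homogeneous f n H.

(* k -> (a)^{<omega}_{<k} *)
Definition arrow_finite (k a : V) : Prop :=
  forall c, c ∈ k ->
  forall f : V -> V, (forall n x, subset_of_size n k x -> f x ∈ c) ->
    exists H, H ⊆ k /\ has_order_type H a /\ forall n, homogeneous f n H.

Definition weakly_compact (k : V) : Prop :=
  uncountable_cardinal k /\ arrow k k 2 (numeral 2).

Record structure := Structure {
  dom : V;
  rel : V -> V -> Prop;
  prd : V -> Prop
}.

(* De Bruijn indices: [fEx] binds variable 0 of its body. *)
Inductive formula : Type :=
| fEq (i j : nat)
| fRel (i j : nat)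
| fPrd (i : nat)
| fNot (p : formula)
| fAnd (p q : formula)
| fEx (p : formula).

Definition scons (a : V) (e : nat -> V) (n : nat) : V :=
  match n with O => a | S m => e m end.

Fixpoint sat (A : structure) (e : nat -> V) (p : formula) : Prop :=
  match p with
  | fEq i j => e i = e j
  | fRel i j => rel A (e i) (e j)
  | fPrd i => prd A (e i)
  | fNot q => ~ sat A e q
  | fAnd q r => sat A e q /\ sat A e r
  | fEx q => exists a, a ∈ dom A /\ sat A (scons a e) q
  end.

Definition elementary_extension (A B : structure) : Prop :=
  dom A ⊆ dom B /\
  forall (p : formula) (e : nat -> V), (forall n, e n ∈ dom A) ->
    (sat A e p <-> sat B e p).

Definition end_elementary_extension (A B : structure) : Prop :=
  elementary_extension A B /\ dom A <> dom B /\
  forall a, a ∈ dom A ->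
    forall b, (b ∈ dom A /\ rel A b a) <-> (b ∈ dom B /\ rel B b a).

Definition well_founded_structure (A : structure) : Prop :=
  well_founded (fun x y => x ∈ dom A /\ y ∈ dom A /\ rel A x y).

Definition mostowski_collapse (A : structure) (pi : V -> V) : Prop :=
  forall x, x ∈ dom A -> forall z,
    z ∈ pi x <-> exists y, y ∈ dom A /\ rel A y x /\ pi y = z.

(* o(M) is the set of ordinals of the transitive collapse of M; when M is a
   transitive set with the membership relation this is the intersection of M
   with the class of ordinals. *)
Definition ordinal_height (A : structure) (h : V) : Prop :=
  exists pi : V -> V, mostowski_collapse A pi /\
    forall b, b ∈ h <-> ordinal b /\ exists x, x ∈ dom A /\ pi x = b.

Definition R_structure (k S : V) : structure :=
  Structure (R k) mem (fun x => x ∈ S).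

Definition unfoldable (k : V) : Prop :=
  inaccessible k /\
  forall a S, ordinal a -> S ⊆ R k ->
    exists M h, end_elementary_extension (R_structure k S) M /\
      well_founded_structure M /\ ordinal_height M h /\ a ⊆ h.

Definition first_unfoldable (k : V) : Prop :=
  unfoldable k /\ forall l, l ∈ k -> ~ unfoldable l.

(* Main.v *)
Require Import Defs.
From Stdlib Require Import ClassicalEpsilon FunctionalExtensionality
  PropExtensionality Arith Lia List FinFun Cantor.

(** The universe is made a structure for a countable language of Hilbert terms,
    so that every definable relation has a definable choice function.  The
    partition relation provides a class [H] of [omega1] many ordinals below
    [kappa] that are indiscernible for all terms ([arrow_good]).  Let [lam] be
    the least ordinal that belongs to any such class, and fix [H] containing
    it.  Then [lam] turns out to be unfoldable.

    The minimality of [lam] makes regressive definable functions constant.  If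
    [f] is definable and [f s] lies in [s 0] for all increasing sequences [s]
    from [H], vary one entry of [s].  The value stays fixed, or it decreases,
    which is absurd, or it increases; in the last case the uncountably many
    values form a new class of indiscernibles, with a member below [lam]
    ([image_good], [regressive_ordinal]).  Induction on rank replaces ordinals
    by arbitrary sets ([regressive_constant]), and then [H] is indiscernible
    even with parameters from [R lam] ([indiscernible_over]): a
    definably chosen counterexample would be regressive, hence constant, and a
    constant cannot separate three blocks of indiscernibles pairwise.

    Indiscernibility over [R lam] gives the rest.  A short unbounded map into
    [lam] would take the same values for every member of [H], and would thus be
    bounded by [lam] at the next one; a power set of size at least [lam] would
    have equal subsets at different indices.  So [lam] is inaccessible.  The
    structures [R h] with a definable predicate, for [h] in [H], form an
    elementary chain, and the type of [H] over [R lam] can be stretched: for an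
    ordinal [alpha], take terms with parameters from [R lam] and indices up to
    [alpha], and decide relations between them by placing the countably many
    indices involved into [H] in an order preserving way, which is possible as
    [H] is uncountable.  A descending sequence of such terms would be placed
    onto a descending sequence of sets, so the model is well-founded; an
    element below a member of [R lam] is equal to a member of [R lam] by
    indiscernibility ([ev_below]), so the extension is an end extension
    ([arbitrarily_high_extensions]).  As the language contains a function that
    picks, at each ordinal, a predicate without extensions of some height
    whenever there is one, every predicate on [R lam] has extensions of every
    height. *)

(** * Ordinals and countable classes *)

Lemma mem_irrefl x : ~ x ∈ x.
Proof. induction (mem_wf x) as [x _ IH]; intros H; exact (IH x H H). Qed.

Lemma mem_asym x y : x ∈ y -> ~ y ∈ x.
Proof.
  revert y; induction (mem_wf x) as [x _ IH]; intros y H K; exact (IH y K x K H).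
Qed.

Lemma ordinal_trans a x y : ordinal a -> x ∈ y -> y ∈ a -> x ∈ a.
Proof. intros [T _] H K; exact (T y K x H). Qed.

Lemma rank_ordinal_id a : ordinal a -> rank a = a.
Proof.
  induction (mem_wf a) as [a _ IH]; intros Ha.
  apply V_ext; intros z; rewrite mem_rank; split.
  - intros [y [Hy H]]; rewrite (IH y Hy (ordinal_mem _ _ Ha Hy)) in H.
    destruct H as [H| ->]; [exact (proj1 Ha y Hy z H) | exact Hy].
  - intros Hz; exists z; split; [exact Hz|]; right; symmetry.
    exact (IH z Hz (ordinal_mem _ _ Ha Hz)).
Qed.

Lemma rank_mem x y : x ∈ y -> rank x ∈ rank y.
Proof. intros H; apply mem_rank; exists x; auto. Qed.

Lemma R_mono a b : a ⊆ b -> R a ⊆ R b.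
Proof.
  intros H x Hx; apply mem_R in Hx; destruct Hx as [c [Hc Hx]].
  apply mem_R; exists c; auto.
Qed.

Lemma R_transitive a : transitive (R a).
Proof.
  induction (mem_wf a) as [a _ IH]; intros y Hy z Hz.
  apply mem_R in Hy; destruct Hy as [b [Hb Hy]].
  apply mem_R; exists b; split; [exact Hb|].
  exact (IH b Hb z (Hy z Hz)).
Qed.

Lemma ordinal_mem_R a x : ordinal a -> x ∈ a -> x ∈ R a.
Proof.
  intros Ha Hx; apply mem_R_rank; [exact Ha|].
  rewrite rank_ordinal_id; [exact Hx | exact (ordinal_mem _ _ Ha Hx)].
Qed.

Lemma ordinal_not_mem a b : ordinal a -> ordinal b -> ~ b ∈ a -> a ⊆ b.
Proof.
  intros Ha Hb N x Hx; destruct (ordinal_tricho a b Ha Hb) as [H|[->|H]].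
  - exact (ordinal_trans b x a Hb Hx H).
  - exact Hx.
  - contradiction.
Qed.

Lemma succ_ordinal a : ordinal a -> ordinal (succ a).
Proof.
  intros Ha; split.
  - intros y Hy z Hz; apply mem_succ; apply mem_succ in Hy; left.
    destruct Hy as [Hy| ->]; [exact (ordinal_trans _ _ _ Ha Hz Hy) | exact Hz].
  - intros x y Hx Hy; apply mem_succ in Hx; apply mem_succ in Hy.
    destruct Hx as [Hx| ->]; destruct Hy as [Hy| ->]; auto.
    now apply (proj2 Ha).
Qed.

Lemma mem_minimal (P : V -> Prop) x : P x ->
  exists m, P m /\ forall y, y ∈ m -> ~ P y.
Proof.
  induction (mem_wf x) as [x _ IH]; intros Hx.
  destruct (classic (exists y, y ∈ x /\ P y)) as [[y [Hy Py]]|N].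
  - exact (IH y Hy Py).
  - exists x; split; [exact Hx|]; intros y Hy Py; apply N; now exists y.
Qed.

Lemma no_descending (d : nat -> V) : ~ forall n, d (S n) ∈ d n.
Proof.
  intros H; assert (K : forall x n, d n <> x).
  { intros x; induction (mem_wf x) as [x _ IH]; intros n <-.
    exact (IH _ (H n) (S n) eq_refl). }
  exact (K _ 0 eq_refl).
Qed.

(** The recipe [C] receives the graph of the function on the members of its
    argument, so that it can ask which values have been used already. *)
Lemma mem_recursion (C : V -> (V -> V -> Prop) -> V) :
  exists G : V -> V, forall x, G x = C x (fun y v => y ∈ x /\ v = G y).
Proof.
  exists (Fix mem_wf (fun _ => V)
    (fun x rec => C x (fun y v => exists h : y ∈ x, v = rec y h))).
  intros x; rewrite Fix_eq.
  - f_equal; apply functional_extensionality; intros y.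
    apply functional_extensionality; intros v.
    apply propositional_extensionality; split.
    + intros [h E]; now split.
    + intros [h E]; now exists h.
  - intros z f g E; f_equal; apply functional_extensionality; intros y.
    apply functional_extensionality; intros v.
    apply propositional_extensionality.
    split; intros [h K]; exists h; [rewrite <- E | rewrite E]; exact K.
Qed.

Definition countable (P : V -> Prop) : Prop :=
  exists f : V -> nat, forall x y, P x -> P y -> f x = f y -> x = y.

Lemma countable_sub (P Q : V -> Prop) :
  countable Q -> (forall x, P x -> Q x) -> countable P.
Proof. intros [f Hf] H; exists f; intros x y Hx Hy; apply Hf; auto. Qed.

Lemma countable_image (P Q : V -> Prop) (F : V -> V) : countable P ->
  (forall y, Q y -> exists x, P x /\ y = F x) -> countable Q.
Proof.
  intros [f Hf] H.
  exists (fun y => f (epsilon (inhabits empty) (fun x => P x /\ y = F x))).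
  intros y z Hy Hz.
  destruct (epsilon_spec (inhabits empty) _ (H y Hy)) as [Py Ey].
  destruct (epsilon_spec (inhabits empty) _ (H z Hz)) as [Pz Ez].
  intros E; rewrite Ey, Ez; f_equal; now apply Hf.
Qed.

Lemma countable_union (P : nat -> V -> Prop) :
  (forall n, countable (P n)) -> countable (fun x => exists n, P n x).
Proof.
  intros H; destruct (choice _ H) as [f Hf].
  set (N := fun x => epsilon (inhabits 0) (fun n => P n x)).
  exists (fun x => to_nat (N x, f (N x) x)); intros x y Hx Hy E.
  assert (Px : P (N x) x) by exact (epsilon_spec (inhabits 0) _ Hx).
  assert (Py : P (N y) y) by exact (epsilon_spec (inhabits 0) _ Hy).
  apply (f_equal of_nat) in E; rewrite !cancel_of_to in E.
  injection E as E1 E2; rewrite E1 in Px, E2; exact (Hf _ _ _ Px Py E2).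
Qed.

Lemma countable_or (P Q : V -> Prop) :
  countable P -> countable Q -> countable (fun x => P x \/ Q x).
Proof.
  intros HP HQ.
  apply countable_sub with (fun x => exists n, match n with 0 => P x | _ => Q x end).
  - apply countable_union; intros [|n]; assumption.
  - intros x [H|H]; [now exists 0 | now exists 1].
Qed.

Lemma countable_range (s : nat -> V) : countable (fun x => exists n, x = s n).
Proof.
  apply countable_union; intros n; exists (fun _ => 0); intros x y -> ->; auto.
Qed.

Lemma uncountable_inhabited P : ~ countable P -> exists x, P x.
Proof.
  intros N; apply NNPP; intros K; apply N; exists (fun _ => 0); intros x y Hx.
  contradiction K; now exists x.
Qed.

Lemma no_descending_wf {A : Type} (r : A -> A -> Prop) :
  (forall d : nat -> A, ~ forall n, r (d (S n)) (d n)) -> well_founded r.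
Proof.
  intros N x; apply NNPP; intros Nx.
  assert (St : forall y : {y | ~ Acc r y}, exists z : {y | ~ Acc r y},
    r (proj1_sig z) (proj1_sig y)).
  { intros [y Ny]; apply NNPP; intros K; apply Ny; constructor; intros z Hz.
    apply NNPP; intros Nz; apply K; now exists (exist _ z Nz). }
  destruct (choice _ St) as [f Hf].
  set (d := fix d n := match n with 0 => exist _ x Nx | S n => f (d n) end).
  apply (N (fun n => proj1_sig (d n))); intros n; apply Hf.
Qed.

Lemma not_mem_empty x : ~ x ∈ empty.
Proof. intros H; unfold empty in H; rewrite mem_set_of in H; destruct H as [[] _]. Qed.

Lemma numeral_ordinal n : ordinal (numeral n).
Proof.
  induction n as [|n IH]; [|now apply succ_ordinal].
  split; intros x; [intros H0|intros y H0]; now apply not_mem_empty in H0.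
Qed.

Lemma numeral_inj n m : numeral n = numeral m -> n = m.
Proof.
  assert (L : forall m n, n < m -> numeral n ∈ numeral m).
  { clear; intros m n Hnm; induction Hnm as [|m _ IH]; simpl; apply mem_succ;
      auto. }
  intros E; destruct (Nat.lt_trichotomy n m) as [K|[K|K]]; [|exact K|];
    apply L in K; rewrite E in K; now apply mem_irrefl in K.
Qed.

Lemma mem_omega x : x ∈ omega <-> exists n, x = numeral n.
Proof.
  unfold omega; rewrite mem_set_of; split; intros [n E]; exists n; auto.
Qed.

Lemma omega_ordinal : ordinal omega.
Proof.
  split.
  - intros y Hy z Hz; apply mem_omega in Hy; destruct Hy as [n ->].
    induction n as [|n IH]; [now apply not_mem_empty in Hz|].
    simpl in Hz; apply mem_succ in Hz; destruct Hz as [Hz| ->]; auto.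
    apply mem_omega; now exists n.
  - intros x y Hx Hy; apply mem_omega in Hx; apply mem_omega in Hy.
    destruct Hx as [n ->], Hy as [m ->].
    apply ordinal_tricho; apply numeral_ordinal.
Qed.

Lemma injects_omega_countable a : injects a omega <-> countable (fun x => x ∈ a).
Proof.
  split.
  - intros [f [Hf If]].
    assert (K : forall x, exists n, x ∈ a -> f x = numeral n).
    { intros x; destruct (classic (x ∈ a)) as [Hx|Hx].
      - destruct (proj1 (mem_omega _) (Hf x Hx)) as [n E]; now exists n.
      - exists 0; contradiction. }
    destruct (choice _ K) as [g Hg]; exists g; intros x y Hx Hy E.
    apply If; auto; rewrite (Hg x Hx), (Hg y Hy); now rewrite E.
  - intros [g Ig]; exists (fun x => numeral (g x)); split.
    + intros x _; apply mem_omega; now exists (g x).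
    + intros x y Hx Hy E; apply Ig; auto; now apply numeral_inj.
Qed.

(** A bijection of a smaller ordinal onto [k] is in particular unbounded. *)
Lemma regular_cardinal k : ordinal k -> regular k -> cardinal k.
Proof.
  intros Ok Rk; split; [exact Ok|]; intros a Ha [f [Hf [_ Sf]]].
  destruct (Rk a f Ha Hf) as [b [Hb B]]; destruct (Sf b Hb) as [x [Hx <-]].
  exact (mem_irrefl _ (B x Hx)).
Qed.

Lemma elem_mem x (i : index x) : elem x i ∈ x.
Proof. now exists i. Qed.

Definition well_orders (E : V -> V) (t a : V) : Prop :=
  ordinal t /\ (forall x, x ∈ t -> E x ∈ a) /\
  (forall x y, x ∈ t -> y ∈ t -> E x = E y -> x = y) /\
  forall c, c ∈ a -> exists x, x ∈ t /\ E x = c.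

(** Members of [a] are chosen greedily along the ordinals; the choice must come
    to an end since an injection of all ordinals into [a] would make them a
    set. *)
Lemma well_ordering a : exists E t, well_orders E t a.
Proof.
  destruct (mem_recursion (fun _ g => epsilon (inhabits empty)
    (fun v => v ∈ a /\ forall y u, g y u -> u <> v))) as [E HE].
  set (free := fun x => exists v, v ∈ a /\ forall y, y ∈ x -> E y <> v).
  assert (Sp : forall x, free x -> E x ∈ a /\ forall y, y ∈ x -> E y <> E x).
  { intros x [v [Hv Fv]].
    destruct (epsilon_spec (inhabits empty)
      (fun v => v ∈ a /\ forall y u, y ∈ x /\ u = E y -> u <> v)) as [A B].
    - exists v; split; [exact Hv|]; intros y u [Hy ->]; now apply Fv.
    - rewrite <- HE in A, B; split; [exact A|]; intros y Hy.
      now apply (B y). }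
  assert (Inj : forall x y, ordinal x -> ordinal y -> free x -> free y ->
    E x = E y -> x = y).
  { intros x y Ox Oy Fx Fy K.
    destruct (ordinal_tricho x y Ox Oy) as [L|[L|L]]; [|exact L|]; exfalso.
    - now apply (proj2 (Sp y Fy) x).
    - now apply (proj2 (Sp x Fx) y). }
  assert (Stop : exists t, ordinal t /\ ~ free t).
  { apply NNPP; intros N.
    assert (Fr : forall x, ordinal x -> free x).
    { intros x Ox; apply NNPP; intros K; apply N; now exists x. }
    set (O := set_of (index a) (fun i =>
      epsilon (inhabits empty) (fun x => ordinal x /\ E x = elem a i))).
    assert (HO : forall x, ordinal x -> x ∈ O).
    { intros x Ox; destruct (Sp x (Fr x Ox)) as [[i Ei] _].
      apply mem_set_of; exists i.
      destruct (epsilon_spec (inhabits empty)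
        (fun x => ordinal x /\ E x = elem a i)) as [A B]; [now exists x|].
      apply Inj; auto; congruence. }
    apply (mem_irrefl (rank O)).
    rewrite <- (rank_ordinal_id (rank O)) at 1 by apply rank_ordinal.
    apply rank_mem, HO, rank_ordinal. }
  destruct Stop as [t0 Ht0].
  destruct (mem_minimal (fun t => ordinal t /\ ~ free t) t0 Ht0)
    as [t [[Ot Nt] Mt]].
  assert (Ft : forall x, x ∈ t -> ordinal x /\ free x).
  { intros x Hx; assert (Ox := ordinal_mem _ _ Ot Hx); split; [exact Ox|].
    apply NNPP; intros K; now apply (Mt x Hx). }
  exists E, t; split; [exact Ot|]; split; [|split].
  - intros x Hx; apply Sp, Ft, Hx.
  - intros x y Hx Hy; apply Inj; now apply Ft.
  - intros c Hc; apply NNPP; intros K; apply Nt; exists c; split; [exact Hc|].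
    intros y Hy Ey; apply K; now exists y.
Qed.

(** * Sequences of ordinals *)

Definition env := nat -> V.

Definition skip (k n : nat) : nat := if n <? k then n else S n.

Lemma skip_mono k m n : m < n -> skip k m < skip k n.
Proof.
  unfold skip; intros; destruct (Nat.ltb_spec m k), (Nat.ltb_spec n k); lia.
Qed.

Definition splice (i : nat) (s t : env) : env :=
  fun n => if n <? i then s n else t (n - i).

Lemma splice_lt i s t n : n < i -> splice i s t n = s n.
Proof. unfold splice; intros H; destruct (Nat.ltb_spec n i); [auto|lia]. Qed.

Lemma splice_ge i s t n : splice i s t (i + n) = t n.
Proof.
  unfold splice; destruct (Nat.ltb_spec (i + n) i); [lia|]; f_equal; lia.
Qed.

Definition shift (N : nat) (s : env) : env := fun n => s (N + n).

Lemma shift_splice N s b : shift N (splice N s b) = b.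
Proof. apply functional_extensionality; intros n; apply splice_ge. Qed.

Definition enumerates (x : V) (m : nat) (s : env) : Prop :=
  (forall n, n < m -> s n ∈ x) /\
  (forall a b, a < b -> b < m -> s a ∈ s b) /\
  (forall y, y ∈ x -> exists n, n < m /\ s n = y).

(** By induction on the position: in either enumeration the next value is the
    least member of [x] not listed before. *)
Lemma enumerates_agree x m s m' s' :
  enumerates x m s -> enumerates x m' s' ->
  forall n, n < m -> n < m' /\ s n = s' n.
Proof.
  intros [M1 [I1 S1]] [M2 [I2 S2]] n; induction n as [n IH] using lt_wf_ind.
  intros Hn.
  assert (Later : forall l, l < m' -> s' l = s n -> n <= l).
  { intros l Hl E; destruct (Nat.le_gt_cases n l) as [L|L]; [exact L|].
    destruct (IH l L) as [_ El]; [lia|].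
    exfalso; apply (mem_irrefl (s n)); rewrite <- E at 1; rewrite <- El.
    now apply I1. }
  destruct (S2 (s n) (M1 n Hn)) as [l [Hl El]]; assert (Ll := Later l Hl El).
  split; [lia|].
  destruct (S1 (s' n)) as [k [Hk Ek]]; [apply M2; lia|].
  destruct (Nat.lt_trichotomy k n) as [L|[->|L]].
  - destruct (IH k L Hk) as [_ Ek']; exfalso; apply (mem_irrefl (s' n)).
    rewrite <- Ek at 1; rewrite Ek'; apply I2; lia.
  - now symmetry in Ek.
  - destruct (Nat.eq_dec l n) as [->|Nl]; [exact (eq_sym El)|].
    exfalso; apply (mem_asym (s n) (s' n)).
    + rewrite <- Ek; now apply I1.
    + rewrite <- El; apply I2; lia.
Qed.

Definition initial_range (s : env) (m : nat) : V :=
  set_of {n | n < m} (fun n => s (proj1_sig n)).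

Lemma mem_initial_range s m x :
  x ∈ initial_range s m <-> exists n, n < m /\ s n = x.
Proof.
  unfold initial_range; rewrite mem_set_of; split.
  - intros [[n Hn] E]; now exists n.
  - intros [n [Hn E]]; now exists (exist _ n Hn).
Qed.

(** Rewrites finitely many indices as a pattern [rho] over an increasing list,
    which reduces arbitrary arguments of a term to increasing ones. *)
Lemma sort_sequence (y : env) N : (forall n, ordinal (y n)) ->
  exists k (x : env) (rho : nat -> nat),
    (forall n, n < N -> rho n < k /\ x (rho n) = y n) /\
    (forall a b, a < b -> b < k -> x a ∈ x b) /\
    (forall a, a < k -> exists n, x a = y n).
Proof.
  intros Oy; induction N as [|N (k & x & rho & E & I & Rx)].
  - exists 0, y, (fun n => n); repeat split; intros; lia.
  - destruct (classic (exists a, a < k /\ x a = y N)) as [[a [Ha Ea]]|Nx].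
    { exists k, x, (fun n => if n =? N then a else rho n); split; [|split; auto].
      intros n Hn; destruct (Nat.eqb_spec n N) as [->|]; auto; apply E; lia. }
    assert (Pos : exists c, c <= k /\ (forall a, a < c -> x a ∈ y N) /\
      (forall a, c <= a -> a < k -> y N ∈ x a)).
    { assert (T : forall a, a < k -> x a ∈ y N \/ y N ∈ x a).
      { intros a Ha; destruct (Rx a Ha) as [n En].
        destruct (ordinal_tricho (x a) (y N)) as [L|[L|L]]; auto.
        - rewrite En; auto.
        - contradiction Nx; now exists a. }
      clear - T I Oy; induction k as [|k IH].
      - exists 0; repeat split; intros; lia.
      - destruct IH as [c [Hc [C1 C2]]]; auto.
        destruct (T k) as [L|L]; [lia| |].
        + destruct (Nat.eq_dec c k) as [->|Nc].
          * exists (S k); split; [lia|]; split; [|intros; lia].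
            intros a Ha; destruct (Nat.eq_dec a k) as [->|]; [exact L|].
            apply C1; lia.
          * exfalso; assert (B := C2 c (le_n c)).
            assert (A : x c ∈ x k) by (apply I; lia).
            assert (Oc := ordinal_trans _ _ _ (Oy N) A L).
            apply mem_asym in Oc; apply Oc, B; lia.
        + exists c; split; [lia|]; split; [exact C1|].
          intros a Ca Ha; destruct (Nat.eq_dec a k) as [->|]; [exact L|].
          apply C2; lia. }
    destruct Pos as [c [Hc [C1 C2]]].
    exists (S k), (fun a => if a <? c then x a else if a =? c then y N else x (a - 1)),
      (fun n => if n =? N then c else if rho n <? c then rho n else S (rho n)).
    split; [|split].
    + intros n Hn; destruct (Nat.eqb_spec n N) as [->|Nn].
      * split; [lia|]; destruct (Nat.ltb_spec c c); [lia|].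
        now rewrite Nat.eqb_refl.
      * destruct (E n) as [En En']; [lia|].
        destruct (Nat.ltb_spec (rho n) c) as [L|L].
        -- split; [lia|]; destruct (Nat.ltb_spec (rho n) c); [exact En'|lia].
        -- split; [lia|]; destruct (Nat.ltb_spec (S (rho n)) c); [lia|].
           destruct (Nat.eqb_spec (S (rho n)) c); [lia|].
           now replace (S (rho n) - 1) with (rho n) by lia.
    + intros a b Hab Hb.
      destruct (Nat.ltb_spec a c), (Nat.ltb_spec b c),
        (Nat.eqb_spec a c), (Nat.eqb_spec b c); try lia; auto.
      * apply I; lia.
      * apply I; lia.
      * apply C2; lia.
      * apply I; lia.
    + intros a Ha; destruct (Nat.ltb_spec a c); [apply Rx; lia|].
      destruct (Nat.eqb_spec a c); [now exists N | apply Rx; lia].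
Qed.

(** * Hilbert terms *)

(** [TEps i b t] is component [i] of a chosen sequence of members of [b] that
    satisfies [t].  It gives definable Skolem functions, and thereby bounded
    quantifiers; binding a whole sequence at once allows several witnesses to be
    chosen together without coding tuples as sets. *)
Inductive term : Set :=
| TVar (n : nat)
| TOp (k : nat) (t u : term)
| TEps (i : nat) (b t : term).

(** Sequences are interleaved so that one sequence may carry two kinds of
    variables: bound and free ones, or parameters and indiscernibles. *)
Definition mix (w e : env) : env :=
  fun n => if Nat.even n then w (Nat.div2 n) else e (Nat.div2 n).

Lemma mix_even w e n : mix w e (2 * n) = w n.
Proof. unfold mix; rewrite Nat.even_mul, Nat.div2_double; reflexivity. Qed.

Lemma mix_odd w e n : mix w e (2 * n + 1) = e n.
Proof.
  unfold mix; rewrite Nat.add_1_r, Nat.even_succ, Nat.odd_mul.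
  now rewrite Nat.div2_succ_double.
Qed.

Lemma even_odd_cases n : {m | n = 2 * m} + {m | n = 2 * m + 1}.
Proof.
  assert (H := Nat.div2_odd n); destruct (Nat.odd n); simpl Nat.b2n in H.
  - right; now exists (Nat.div2 n).
  - left; exists (Nat.div2 n); lia.
Qed.

(** Renamings that fix the first of the two interleaved sequences. *)
Lemma mix_comp w e (f : nat -> nat) :
  (forall n, f (2 * n) = 2 * n) ->
  forall r, (forall n, f (2 * n + 1) = 2 * r n + 1) ->
  (fun n => mix w e (f n)) = mix w (fun n => e (r n)).
Proof.
  intros H r K; apply functional_extensionality; intros n.
  destruct (even_odd_cases n) as [[m ->]|[m ->]].
  - now rewrite H, !mix_even.
  - now rewrite K, !mix_odd.
Qed.

Definition tv (P : Prop) : V :=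
  if excluded_middle_informative P then succ empty else empty.

Definition holds (v : V) : Prop := v <> empty.

Lemma holds_tv P : holds (tv P) <-> P.
Proof.
  unfold holds, tv; destruct (excluded_middle_informative P) as [H|H].
  - split; [auto|]; intros _ E; apply (not_mem_empty empty).
    rewrite <- E at 2; apply mem_succ; auto.
  - split; [|contradiction]; intros K; now contradiction K.
Qed.

Lemma tv_ext P Q : (P <-> Q) -> tv P = tv Q.
Proof.
  intros H; f_equal; now apply propositional_extensionality.
Qed.

Lemma tv_two P : tv P ∈ numeral 2.
Proof.
  simpl; unfold tv; destruct (excluded_middle_informative P); apply mem_succ;
    [now right|left]; apply mem_succ; now right.
Qed.

Definition valid_choice (b : V) (P : env -> Prop) (w : env) : Prop :=
  (forall n, w n ∈ b) /\ P w.

Definition choose_env (b : V) (P : env -> Prop) : env :=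
  match excluded_middle_informative (exists w, valid_choice b P w) with
  | left H => proj1_sig (constructive_indefinite_description _ H)
  | right _ => fun _ => empty
  end.

Lemma choose_env_spec b P :
  (exists w, valid_choice b P w) -> valid_choice b P (choose_env b P).
Proof.
  intros H; unfold choose_env.
  destruct (excluded_middle_informative _) as [K|K]; [|contradiction].
  exact (proj2_sig (constructive_indefinite_description _ K)).
Qed.

(** The default value is a constant sequence, so membership of one component
    in [b] already gives membership of all of them. *)
Lemma choose_env_valid b P :
  choose_env b P 0 ∈ b -> P (choose_env b P) -> exists w, valid_choice b P w.
Proof.
  unfold choose_env; destruct (excluded_middle_informative _) as [K|K]; auto.
  intros H0 HP; exists (fun _ => empty); split; auto.
Qed.

Section Definability.

Variable F : nat -> V -> V -> V.

Definition op (k : nat) (x y : V) : V :=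
  match k with
  | 0 => tv (x ∈ y)
  | 1 => tv (x = y)
  | 2 => tv (~ (holds x /\ holds y))
  | 3 => R x
  | 4 => rank x
  | S (S (S (S (S k)))) => F k x y
  end.

Fixpoint eval (t : term) (e : env) : V :=
  match t with
  | TVar n => e n
  | TOp k t u => op k (eval t e) (eval u e)
  | TEps i b t => choose_env (eval b e) (fun w => holds (eval t (mix w e))) i
  end.

(** Passage of a substitution under a binder, whose bound variables are the even
    ones. *)
Definition lift (s : nat -> term) (n : nat) : term :=
  if Nat.even n then TVar n else s (Nat.div2 n).

Fixpoint rename (r : nat -> nat) (t : term) : term :=
  match t with
  | TVar n => TVar (r n)
  | TOp k t u => TOp k (rename r t) (rename r u)
  | TEps i b t => TEps i (rename r b)
      (rename (fun n => if Nat.even n then n else 2 * r (Nat.div2 n) + 1) t)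
  end.

Lemma eval_rename t r e : eval (rename r t) e = eval t (fun n => e (r n)).
Proof.
  revert r e; induction t as [n|k t IHt u IHu|i b IHb t IHt]; intros r e; simpl.
  - reflexivity.
  - now rewrite IHt, IHu.
  - rewrite IHb; f_equal; apply functional_extensionality; intros w.
    rewrite IHt; do 2 f_equal; apply mix_comp.
    + intros n; rewrite Nat.even_mul; reflexivity.
    + intros n; rewrite Nat.add_1_r, Nat.even_succ, Nat.odd_mul; simpl andb.
      cbv iota; rewrite Nat.div2_succ_double; lia.
Qed.

Fixpoint subst (s : nat -> term) (t : term) : term :=
  match t with
  | TVar n => s n
  | TOp k t u => TOp k (subst s t) (subst s u)
  | TEps i b t => TEps i (subst s b)
      (subst (lift (fun n => rename (fun m => 2 * m + 1) (s n))) t)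
  end.

Lemma eval_subst t s e : eval (subst s t) e = eval t (fun n => eval (s n) e).
Proof.
  revert s e; induction t as [n|k t IHt u IHu|i b IHb t IHt]; intros s e; simpl.
  - reflexivity.
  - now rewrite IHt, IHu.
  - rewrite IHb; f_equal; apply functional_extensionality; intros w.
    rewrite IHt; do 2 f_equal; apply functional_extensionality; intros n.
    unfold lift, mix at 2; destruct (Nat.even n) eqn:En.
    + simpl; unfold mix; now rewrite En.
    + rewrite eval_rename; f_equal; apply functional_extensionality; intros m.
      apply mix_odd.
Qed.

Lemma eval_support t :
  exists N, forall e e', (forall n, n < N -> e n = e' n) -> eval t e = eval t e'.
Proof.
  induction t as [n|k t [N HN] u [M HM]|i b [N HN] t [M HM]].
  - exists (S n); intros e e' H; apply H; lia.
  - exists (N + M); intros e e' H; simpl; f_equal;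
      [apply HN | apply HM]; intros; apply H; lia.
  - exists (N + M); intros e e' H; simpl.
    rewrite (HN e e') by (intros; apply H; lia).
    f_equal; apply functional_extensionality; intros w; f_equal; apply HM.
    intros n Hn; unfold mix; destruct (Nat.even n); [reflexivity|].
    apply H; assert (K := Nat.div2_odd n); lia.
Qed.

(** * Definable functions *)

Definition definable (f : env -> V) : Prop := exists t, forall e, eval t e = f e.

Definition definable_pred (P : env -> Prop) : Prop :=
  definable (fun e => tv (P e)).

Lemma definable_support f : definable f ->
  exists N, forall e e', (forall n, n < N -> e n = e' n) -> f e = f e'.
Proof.
  intros [t Ht]; destruct (eval_support t) as [N HN]; exists N; intros e e' H.
  rewrite <- !Ht; now apply HN.
Qed.

Lemma definable_pred_support P : definable_pred P ->
  exists N, forall e e', (forall n, n < N -> e n = e' n) -> P e <-> P e'.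
Proof.
  intros HP; destruct (definable_support _ HP) as [N HN]; exists N.
  intros e e' E; rewrite <- (holds_tv (P e)), <- (holds_tv (P e')).
  now rewrite (HN e e' E).
Qed.

Lemma definable_var n : definable (fun e => e n).
Proof. now exists (TVar n). Qed.

Lemma definable_op k f g : definable f -> definable g ->
  definable (fun e => op k (f e) (g e)).
Proof.
  intros [t Ht] [u Hu]; exists (TOp k t u); intros e; simpl; now rewrite Ht, Hu.
Qed.

Lemma definable_fun k f g : definable f -> definable g ->
  definable (fun e => F k (f e) (g e)).
Proof. exact (definable_op (S (S (S (S (S k))))) f g). Qed.

Lemma definable_subst f (s : nat -> env -> V) : definable f ->
  (forall n, definable (s n)) -> definable (fun e => f (fun n => s n e)).
Proof.
  intros [t Ht] H; destruct (choice _ H) as [u Hu]; exists (subst u t).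
  intros e; rewrite eval_subst, Ht; f_equal.
  apply functional_extensionality; intros n; apply Hu.
Qed.

Lemma definable_rename f (r : nat -> nat) : definable f ->
  definable (fun e => f (fun n => e (r n))).
Proof.
  intros H; apply (definable_subst f (fun n e => e (r n)) H).
  intros n; apply definable_var.
Qed.

Lemma definable_eps i b f : definable b -> definable f ->
  definable (fun e => choose_env (b e) (fun w => holds (f (mix w e))) i).
Proof.
  intros [t Ht] [u Hu]; exists (TEps i t u); intros e; simpl; rewrite Ht.
  f_equal; apply functional_extensionality; intros w; now rewrite Hu.
Qed.

Lemma definable_ext f g : definable f -> (forall e, f e = g e) -> definable g.
Proof. intros [t Ht] H; exists t; intros e; now rewrite Ht. Qed.

Lemma definable_pred_ext P Q : definable_pred P -> (forall e, P e <-> Q e) ->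
  definable_pred Q.
Proof.
  intros H E; apply (definable_ext _ _ H); intros e; now apply tv_ext.
Qed.

Lemma definable_mem f g : definable f -> definable g ->
  definable_pred (fun e => f e ∈ g e).
Proof. exact (definable_op 0 f g). Qed.

Lemma definable_eq f g : definable f -> definable g ->
  definable_pred (fun e => f e = g e).
Proof. exact (definable_op 1 f g). Qed.

Lemma definable_nand P Q : definable_pred P -> definable_pred Q ->
  definable_pred (fun e => ~ (P e /\ Q e)).
Proof.
  intros HP HQ; apply (definable_ext _ _ (definable_op 2 _ _ HP HQ)); intros e.
  simpl; apply tv_ext; now rewrite !holds_tv.
Qed.

Lemma definable_not P : definable_pred P -> definable_pred (fun e => ~ P e).
Proof.
  intros H; apply (definable_pred_ext _ _ (definable_nand _ _ H H)); tauto.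
Qed.

Lemma definable_and P Q : definable_pred P -> definable_pred Q ->
  definable_pred (fun e => P e /\ Q e).
Proof.
  intros HP HQ.
  apply (definable_pred_ext _ _ (definable_not _ (definable_nand _ _ HP HQ))).
  intros e; tauto.
Qed.

Lemma definable_iff P Q : definable_pred P -> definable_pred Q ->
  definable_pred (fun e => P e <-> Q e).
Proof.
  intros HP HQ.
  apply (definable_pred_ext _ _ (definable_and _ _
    (definable_nand _ _ HP (definable_not _ HQ))
    (definable_nand _ _ (definable_not _ HP) HQ))).
  intros e; tauto.
Qed.

Lemma definable_R f : definable f -> definable (fun e => R (f e)).
Proof. intros H; exact (definable_op 3 f f H H). Qed.

Lemma definable_rank f : definable f -> definable (fun e => rank (f e)).
Proof. intros H; exact (definable_op 4 f f H H). Qed.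

Lemma definable_holds f : definable f -> definable_pred (fun e => holds (f e)).
Proof.
  intros H; apply (definable_ext _ _ (definable_op 2 _ _ (definable_op 2 _ _ H H)
    (definable_op 2 _ _ H H))).
  intros e; simpl; apply tv_ext; rewrite !holds_tv; tauto.
Qed.

Lemma definable_pred_subst P (s : nat -> env -> V) : definable_pred P ->
  (forall n, definable (s n)) -> definable_pred (fun e => P (fun n => s n e)).
Proof. exact (definable_subst (fun e => tv (P e)) s). Qed.

(** The chosen sequence [q] is itself definable, so the quantifier amounts to
    substituting it; testing [q 0] rules out the default value. *)
Lemma definable_ex b P : definable b -> definable_pred P ->
  definable_pred (fun e => exists w, valid_choice (b e) (fun w => P (mix w e)) w).
Proof.
  intros Hb HP.
  set (q := fun i e => choose_env (b e) (fun w => holds (tv (P (mix w e)))) i).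
  assert (Hq : forall i, definable (q i)) by exact (fun i => definable_eps i b (fun e => tv (P e)) Hb HP).
  apply (definable_pred_ext (fun e => q 0 e ∈ b e /\ P (mix (fun i => q i e) e))).
  - apply definable_and; [now apply definable_mem|].
    apply (definable_pred_subst P (fun n e => mix (fun i => q i e) e n) HP).
    intros n; destruct (even_odd_cases n) as [[m ->]|[m ->]].
    + apply (definable_ext _ _ (Hq m)); intros e; now rewrite mix_even.
    + apply (definable_ext _ _ (definable_var m)); intros e; now rewrite mix_odd.
  - intros e.
    assert (E : (fun w => holds (tv (P (mix w e)))) = fun w => P (mix w e)).
    { apply functional_extensionality; intros w.
      apply propositional_extensionality, holds_tv. }
    unfold q; rewrite E; split.
    + intros [H0 HP0]; now apply choose_env_valid.
    + intros H; apply choose_env_spec in H; destruct H as [H K]; split; auto.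
Qed.

Fixpoint code (t : term) : nat :=
  match t with
  | TVar n => to_nat (0, n)
  | TOp k t u => to_nat (1, to_nat (k, to_nat (code t, code u)))
  | TEps i b t => to_nat (2, to_nat (i, to_nat (code b, code t)))
  end.

Lemma code_inj t u : code t = code u -> t = u.
Proof.
  revert u; induction t as [n|k t IHt u IHu|i b IHb t IHt];
    intros [n'|k' t' u'|i' b' t'] H; cbn [code] in H;
    apply to_nat_inj, pair_equal_spec in H; destruct H as [E H];
    try discriminate; [now subst| |];
    apply to_nat_inj, pair_equal_spec in H; destruct H as [-> H];
    apply to_nat_inj, pair_equal_spec in H; destruct H as [H1 H2];
    f_equal; auto.
Qed.

Definition decode (n : nat) : term :=
  epsilon (inhabits (TVar 0)) (fun t => code t = n).

Lemma decode_code t : decode (code t) = t.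
Proof.
  apply code_inj.
  exact (epsilon_spec (inhabits (TVar 0)) (fun u => code u = code t)
    (ex_intro _ t eq_refl)).
Qed.

(** * Uncountable classes of indiscernible ordinals *)

Definition increasing (H : V -> Prop) (s : env) : Prop :=
  (forall n, H (s n)) /\ forall m n, m < n -> s m ∈ s n.

Variable kappa : V.
Hypothesis kappa_ordinal : ordinal kappa.

(** The analogue of a homogeneous set of order type [omega1], stated in the form
    in which it passes to images.  Indiscernibility is phrased with infinite
    sequences, of which a term uses finitely many entries; this removes arities
    from all arguments. *)
Record good (H : V -> Prop) : Prop := {
  good_sub : forall x, H x -> x ∈ kappa;
  good_uncountable : ~ countable H;
  good_segment : forall x, H x -> countable (fun y => H y /\ y ∈ x);
  good_ind : forall f, definable f -> forall s s',
    increasing H s -> increasing H s' -> (holds (f s) <-> holds (f s'))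
}.

Lemma good_ordinal H x : good H -> H x -> ordinal x.
Proof. intros G Hx; exact (ordinal_mem _ _ kappa_ordinal (good_sub _ G x Hx)). Qed.

Lemma increasing_step H s : good H ->
  (forall n, H (s n)) -> (forall n, s n ∈ s (S n)) -> increasing H s.
Proof.
  intros G HH St; split; [exact HH|]; intros m n Hmn; induction Hmn as [|n _ IH].
  - apply St.
  - exact (ordinal_trans _ _ _ (good_ordinal H _ G (HH (S n))) IH (St n)).
Qed.

Lemma increasing_rename H s (r : nat -> nat) : increasing H s ->
  (forall m n, m < n -> r m < r n) -> increasing H (fun n => s (r n)).
Proof. intros [HH I] K; split; auto. Qed.

Lemma good_tail H x : good H -> H x -> ~ countable (fun y => H y /\ x ∈ y).
Proof.
  intros G Hx C; apply (good_uncountable H G).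
  apply countable_sub with
    (fun y => (H y /\ y ∈ x) \/ (exists n : nat, y = x) \/ (H y /\ x ∈ y)).
  - apply countable_or; [exact (good_segment H G x Hx)|].
    apply countable_or; [exact (countable_range (fun _ => x)) | exact C].
  - intros y Hy.
    destruct (ordinal_tricho y x (good_ordinal H _ G Hy) (good_ordinal H _ G Hx))
      as [K|[K|K]]; auto.
    right; left; now exists 0.
Qed.

Lemma good_above H x y : good H -> H x -> H y -> exists z, H z /\ x ∈ z /\ y ∈ z.
Proof.
  intros G; assert (L : forall x y, H x -> H y -> x ∈ y \/ x = y ->
    exists z, H z /\ x ∈ z /\ y ∈ z).
  { intros a b Ha Hb Hab.
    destruct (uncountable_inhabited _ (good_tail H b G Hb)) as [z [Hz Kz]].
    exists z; split; [exact Hz|]; split; [|exact Kz].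
    destruct Hab as [Hab| ->]; [|exact Kz].
    exact (ordinal_trans _ _ _ (good_ordinal H z G Hz) Hab Kz). }
  intros Hx Hy.
  destruct (ordinal_tricho x y (good_ordinal H _ G Hx) (good_ordinal H _ G Hy))
    as [K|[K|K]]; auto.
  destruct (L y x Hy Hx (or_introl K)) as [z [A [B C]]]; eauto.
Qed.

(** Finite increasing sequences can serve as arguments of definable functions. *)
Lemma good_extend H p k : good H -> (forall n, n < k -> H (p n)) ->
  (forall m n, m < n -> n < k -> p m ∈ p n) ->
  exists s, increasing H s /\ forall n, n < k -> s n = p n.
Proof.
  intros G HH I.
  assert (N : forall x, exists y, H x -> H y /\ x ∈ y).
  { intros x; destruct (classic (H x)) as [Hx|Hx].
    - destruct (good_above H x x G Hx Hx) as [y [A [B _]]]; exists y; auto.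
    - exists x; contradiction. }
  destruct (choice _ N) as [nx Hnx].
  destruct (uncountable_inhabited H (good_uncountable H G)) as [h Hh].
  set (s := fix s n := match n with
    | 0 => if 0 <? k then p 0 else h
    | S n => if S n <? k then p (S n) else nx (s n) end).
  assert (E : forall n, n < k -> s n = p n).
  { intros [|n] Hn; simpl; apply Nat.ltb_lt in Hn; now rewrite Hn. }
  assert (Hs : forall n, H (s n)).
  { induction n as [|n IH]; simpl.
    - destruct (Nat.ltb_spec 0 k); auto.
    - destruct (Nat.ltb_spec (S n) k); [auto | now apply Hnx]. }
  exists s; split; [|exact E].
  apply increasing_step; auto; intros n.
  destruct (Nat.ltb_spec (S n) k) as [K|K].
  - rewrite !E by lia; apply I; lia.
  - simpl; destruct (Nat.ltb_spec (S n) k); [lia|]; now apply Hnx.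
Qed.

Lemma increasing_from H x : good H -> H x ->
  exists s, increasing H s /\ s 0 = x.
Proof.
  intros G Hx; destruct (good_extend H (fun _ => x) 1 G) as [s [Is Es]];
    [auto | intros; lia|]; exists s; auto.
Qed.

Lemma increasing_splice H i s t : good H -> increasing H s -> increasing H t ->
  (forall n, n < i -> s n ∈ t 0) -> increasing H (splice i s t).
Proof.
  intros G [Hs Is] [Ht It] K; apply increasing_step; [exact G| |]; intros n;
    unfold splice.
  - destruct (Nat.ltb_spec n i); auto.
  - destruct (Nat.ltb_spec n i), (Nat.ltb_spec (S n) i); try lia.
    + apply Is; lia.
    + replace (S n - i) with 0 by lia; auto.
    + apply It; lia.
Qed.

Section Least.

Variables (H : V -> Prop) (lam : V).
Hypotheses (G : good H) (Hlam : H lam)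
  (Hmin : forall H', good H' -> forall x, H' x -> ~ x ∈ lam).

(** The function [f] is assumed to depend only on the first [S i] entries of its
    argument in the sense of [fixed_above], and to increase when entry [i] is
    replaced by a later one. *)
Section ImageClass.

Variables (f : env -> V) (i : nat) (s : env).
Hypothesis (Hf : definable f)
  (regressive : forall s, increasing H s -> f s ∈ s 0)
  (fixed_above : forall s s', increasing H s -> increasing H s' ->
    (forall n, n < S i -> s n = s' n) -> f s = f s')
  (Hs : increasing H s)
  (climbs : forall z, increasing H z ->
    f (fun n => z (skip (S i) n)) ∈ f (fun n => z (skip i n))).

Let D y := H y /\ forall n, n < i -> s n ∈ y.

Lemma image_value : forall y, exists v, D y ->
  forall z, increasing H z -> (forall n, n < i -> z n = s n) -> z i = y -> f z = v.
Proof.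
  intros y; destruct (classic (exists z, increasing H z /\
    (forall n, n < i -> z n = s n) /\ z i = y)) as [[z [Iz [Ez Ey]]]|N].
  - exists (f z); intros _ w Iw Ew Ew'; apply fixed_above; auto.
    intros n Hn; destruct (Nat.eq_dec n i) as [->|]; [congruence|].
    rewrite Ez, Ew; auto; lia.
  - exists empty; intros _ w Iw Ew Ew'; contradiction N; now exists w.
Qed.

(** The values [v y] of [f] at sequences with first entries [s 0], .., [s (i-1)],
    [y] increase with [y], so they form a class of the same size.  A term in
    finitely many of them is a term in members of [H], hence they are
    indiscernible again. *)
Lemma image_good : exists H', good H' /\ H' (f s).
Proof.
  destruct (choice _ image_value) as [v Hv].
  destruct Hs as [HsH HsI].
  assert (Ds : D (s i)) by (split; auto).
  assert (P1 : forall y, D y -> exists z, increasing H z /\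
    (forall n, n < i -> z n = s n) /\ z i = y).
  { intros y [Hy Ky].
    destruct (good_extend H (splice i s (fun _ => y)) (S i) G) as [z [Iz Ez]].
    - intros n Hn; unfold splice; destruct (n <? i); auto.
    - intros m n Hmn Hn; unfold splice.
      destruct (Nat.ltb_spec m i), (Nat.ltb_spec n i); auto; lia.
    - exists z; split; [exact Iz|]; split.
      + intros n Hn; rewrite Ez by lia; now apply splice_lt.
      + rewrite Ez by lia; replace i with (i + 0) at 2 by lia; apply splice_ge. }
  assert (vmono : forall y y', D y -> D y' -> y ∈ y' -> v y ∈ v y').
  { intros y y' Dy Dy' Hyy.
    destruct (good_extend H (splice i s (fun n => if n =? 0 then y else y'))
      (S (S i)) G) as [z [Iz Ez]].
    - intros n Hn; unfold splice; destruct (n <? i); auto.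
      destruct (n - i =? 0); [apply Dy | apply Dy'].
    - intros m n Hmn Hn; unfold splice.
      destruct (Nat.ltb_spec m i), (Nat.ltb_spec n i),
        (Nat.eqb_spec (m - i) 0), (Nat.eqb_spec (n - i) 0); try lia; auto;
        [apply Dy | apply Dy']; auto.
    - assert (Z1 : z i = y).
      { rewrite Ez by lia; replace i with (i + 0) at 2 by lia.
        now rewrite splice_ge. }
      assert (Z2 : z (S i) = y').
      { rewrite Ez by lia; replace (S i) with (i + 1) by lia.
        now rewrite splice_ge. }
      assert (Z0 : forall n, n < i -> z n = s n).
      { intros n Hn; rewrite Ez by lia; now apply splice_lt. }
      assert (K := climbs z Iz).
      rewrite (Hv y Dy (fun n => z (skip (S i) n))) in K.
      + rewrite (Hv y' Dy' (fun n => z (skip i n))) in K; [exact K| | |].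
        * apply (increasing_rename _ _ _ Iz), skip_mono.
        * intros n Hn; unfold skip; destruct (Nat.ltb_spec n i); [auto|lia].
        * unfold skip; destruct (Nat.ltb_spec i i); [lia|exact Z2].
      + apply (increasing_rename _ _ _ Iz), skip_mono.
      + intros n Hn; unfold skip; destruct (Nat.ltb_spec n (S i)); [auto|lia].
      + unfold skip; destruct (Nat.ltb_spec i (S i)); [exact Z1|lia]. }
  assert (vrefl : forall y y', D y -> D y' -> v y ∈ v y' -> y ∈ y').
  { intros y y' Dy Dy' K.
    destruct (ordinal_tricho y y' (good_ordinal H _ G (proj1 Dy))
      (good_ordinal H _ G (proj1 Dy'))) as [L|[->|L]]; [exact L| |].
    - now apply mem_irrefl in K.
    - apply (vmono y' y Dy' Dy) in L; now apply mem_asym in L. }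
  assert (vinj : forall y y', D y -> D y' -> v y = v y' -> y = y').
  { intros y y' Dy Dy' E.
    destruct (ordinal_tricho y y' (good_ordinal H _ G (proj1 Dy))
      (good_ordinal H _ G (proj1 Dy'))) as [L|[L|L]]; [|exact L|];
      apply vmono in L; auto; rewrite E in L; now apply mem_irrefl in L. }
  set (H' := fun x => exists y, D y /\ x = v y).
  exists H'; split; [|exists (s i); split; auto; apply Hv; auto; now split].
  assert (Hord : forall x, H' x -> x ∈ kappa).
  { intros x [y [Dy ->]]; destruct (P1 y Dy) as [z [Iz [Ez Ey]]].
    rewrite <- (Hv y Dy z Iz Ez Ey).
    exact (ordinal_trans _ _ _ kappa_ordinal (regressive z Iz)
      (good_sub H G _ (proj1 Iz 0))). }
  constructor.
  - exact Hord.
  - intros [g Hg]; apply (good_tail H (s i) G (HsH i)).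
    assert (DD : forall y, H y /\ s i ∈ y -> D y).
    { intros y [Hy Ky]; split; [exact Hy|]; intros n Hn.
      exact (ordinal_trans _ _ _ (good_ordinal H y G Hy) (HsI n i Hn) Ky). }
    exists (fun y => g (v y)); intros x y Hx Hy E; apply DD in Hx; apply DD in Hy.
    apply vinj; auto; apply Hg; auto; [now exists x | now exists y].
  - intros x [y [Dy ->]].
    apply (countable_image _ _ v (good_segment H G y (proj1 Dy))).
    intros x [[y' [Dy' ->]] K]; exists y'; split; [|reflexivity].
    split; [apply Dy' | now apply vrefl].
  - intros f' Hf'; destruct (definable_support f' Hf') as [N HN].
    (* Value [n] is computed with the fixed entries, then entry [i + n], then
       entries beyond all those that stand for the first [N] values; the latter
       may be the same for all [n] because of [fixed_above]. *)
    set (r := fun n m => if m <? i then m else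
      if m =? i then i + n else i + N + m - i).
    set (g := fun e : env => f' (fun n => f (fun m => e (r n m)))).
    assert (Dg : definable g).
    { apply (definable_subst f' (fun n e => f (fun m => e (r n m))) Hf').
      intros n; now apply definable_rename. }
    assert (K : forall t, increasing H' t ->
      exists z, increasing H z /\ f' t = g z).
    { intros t [Ht It]; destruct (choice _ Ht) as [y Hy].
      assert (Iy : forall m n, m < n -> y m ∈ y n).
      { intros m n Hmn; apply vrefl; [apply Hy|apply Hy|].
        rewrite <- (proj2 (Hy m)), <- (proj2 (Hy n)); auto. }
      assert (Iz : increasing H (splice i s y)).
      { apply increasing_splice; [exact G|exact Hs| |apply Hy].
        split; [|exact Iy]; intros n; apply Hy. }
      exists (splice i s y); split; [exact Iz|]; apply HN; intros n Hn.
      destruct (Hy n) as [Dn ->]; symmetry; apply (Hv _ Dn).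
      - apply increasing_rename; [exact Iz|]; intros a b Hab; unfold r.
        destruct (Nat.ltb_spec a i), (Nat.ltb_spec b i),
          (Nat.eqb_spec a i), (Nat.eqb_spec b i); lia.
      - intros m Hm; unfold r; destruct (Nat.ltb_spec m i); [|lia].
        now apply splice_lt.
      - unfold r; destruct (Nat.ltb_spec i i); [lia|]; rewrite Nat.eqb_refl.
        apply splice_ge. }
    intros t t' It It'; destruct (K t It) as [z [Iz ->]].
    destruct (K t' It') as [z' [Iz' ->]]; now apply (good_ind H G).
Qed.

End ImageClass.

(** Downward induction on [i]: [f] depends only on the first [i] entries.  By
    indiscernibility, replacing entry [i] by a later one has always the same
    effect.  If the value grows, [image_good] yields a class of indiscernibles
    with a member below [lam]; if it shrinks, iteration yields a descending
    sequence; so it does not change. *)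
Lemma regressive_ordinal f : definable f ->
  (forall s, increasing H s -> f s ∈ s 0) ->
  forall s s', increasing H s -> increasing H s' -> f s = f s'.
Proof.
  intros Hf Rg; destruct (definable_support f Hf) as [N HN].
  assert (Fo : forall s, increasing H s -> ordinal (f s)).
  { intros s Is; exact (ordinal_mem _ _ (good_ordinal H _ G (proj1 Is 0)) (Rg s Is)). }
  assert (Claim : forall d i, i + d = N -> forall s s', increasing H s ->
    increasing H s' -> (forall n, n < i -> s n = s' n) -> f s = f s').
  { induction d as [|d IH]; intros i Hi.
    { intros s s' _ _ E; apply HN; intros n Hn; apply E; lia. }
    assert (C : forall s s', increasing H s -> increasing H s' ->
      (forall n, n < S i -> s n = s' n) -> f s = f s') by (apply (IH (S i)); lia).
    assert (Df : forall k, definable (fun e => f (fun n => e (skip k n)))).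
    { intros k; now apply definable_rename. }
    assert (Same : forall P, definable_pred P -> forall z, increasing H z -> P z ->
      forall z, increasing H z -> P z).
    { intros P HP z Iz Pz z' Iz'; apply holds_tv.
      apply (good_ind H G _ HP z z' Iz Iz'), holds_tv, Pz. }
    assert (Isk : forall k z, increasing H z ->
      increasing H (fun n => z (skip k n))).
    { intros k z Iz; apply (increasing_rename _ _ _ Iz), skip_mono. }
    destruct (increasing_from H lam G Hlam) as [z0 [I0 E0]].
    destruct (ordinal_tricho _ _ (Fo _ (Isk (S i) z0 I0)) (Fo _ (Isk i z0 I0)))
      as [K|[K|K]].
    - exfalso.
      assert (Cl := Same _ (definable_mem _ _ (Df (S i)) (Df i)) z0 I0 K).
      destruct (image_good f i z0 Hf Rg C I0 Cl) as [H' [G' Hx]].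
      apply (Hmin H' G' _ Hx); rewrite <- E0; now apply Rg.
    - assert (Eq := Same _ (definable_eq _ _ (Df (S i)) (Df i)) z0 I0 K).
      assert (L : forall s s', increasing H s -> increasing H s' ->
        (forall n, n < i -> s n = s' n) -> s i ∈ s' i -> f s = f s').
      { intros s s' Is Is' E Hlt.
        destruct (good_extend H (splice (S i) s (fun _ => s' i)) (S (S i)) G)
          as [z [Iz Ez]].
        - intros n Hn; unfold splice; destruct (n <? S i); [apply Is | apply Is'].
        - intros m n Hmn Hn; unfold splice.
          destruct (Nat.ltb_spec m (S i)), (Nat.ltb_spec n (S i)); try lia.
          + now apply Is.
          + destruct (Nat.eq_dec m i) as [->|]; [exact Hlt|].
            rewrite E by lia; apply Is'; lia.
        - transitivity (f (fun n => z (skip (S i) n))).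
          + apply C; auto; intros n Hn; unfold skip.
            destruct (Nat.ltb_spec n (S i)); [|lia].
            rewrite Ez by lia; symmetry; now apply splice_lt.
          + rewrite (Eq z Iz); apply C; auto; intros n Hn; unfold skip.
            destruct (Nat.ltb_spec n i).
            * rewrite Ez by lia; rewrite splice_lt by lia; auto.
            * assert (n = i) as -> by lia; rewrite Ez by lia; unfold splice.
              destruct (Nat.ltb_spec (S i) (S i)); [lia|reflexivity]. }
      intros s s' Is Is' E.
      destruct (ordinal_tricho (s i) (s' i) (good_ordinal H _ G (proj1 Is i))
        (good_ordinal H _ G (proj1 Is' i))) as [A|[A|A]].
      + now apply L.
      + apply C; auto; intros n Hn.
        destruct (Nat.eq_dec n i) as [->|]; [exact A | apply E; lia].
      + symmetry; apply L; auto; intros n Hn; symmetry; auto.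
    - exfalso.
      assert (De := Same _ (definable_mem _ _ (Df i) (Df (S i))) z0 I0 K).
      set (r := fun k n => if n <? i then n else n + k).
      assert (Ir : forall k, increasing H (fun n => z0 (r k n))).
      { intros k; apply (increasing_rename _ _ _ I0); intros a b Hab; unfold r.
        destruct (Nat.ltb_spec a i), (Nat.ltb_spec b i); lia. }
      apply (no_descending (fun k => f (fun n => z0 (r k n)))); intros k.
      assert (Dk := De _ (Ir k)); cbv beta in Dk.
      assert (E1 : f (fun n => z0 (r k (skip (S i) n))) = f (fun n => z0 (r k n))).
      { apply C; [exact (Isk (S i) _ (Ir k)) | apply Ir |].
        intros n Hn; unfold skip; destruct (Nat.ltb_spec n (S i)); [auto|lia]. }
      rewrite E1 in Dk.
      replace (fun n => z0 (r (S k) n)) with (fun n => z0 (r k (skip i n)));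
        [exact Dk|].
      apply functional_extensionality; intros n; f_equal; unfold r, skip.
      destruct (Nat.ltb_spec n i); [destruct (Nat.ltb_spec n i); lia|].
      destruct (Nat.ltb_spec (S n) i); lia. }
  intros s s' Is Is'; apply (Claim N 0); auto; intros; lia.
Qed.

Lemma lam_ordinal : ordinal lam.
Proof. exact (good_ordinal H lam G Hlam). Qed.

Lemma lam_le h : H h -> lam ⊆ h.
Proof.
  intros Hh; apply ordinal_not_mem; [apply lam_ordinal| |].
  - exact (good_ordinal H h G Hh).
  - now apply (Hmin H G).
Qed.

Lemma indiscernible P s s' : definable_pred P ->
  increasing H s -> increasing H s' -> P s -> P s'.
Proof.
  intros HP I I' K; apply holds_tv.
  apply (good_ind H G _ HP s s' I I'), holds_tv, K.
Qed.

Lemma common_tail N s s' : increasing H s -> increasing H s' ->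
  exists b, increasing H b /\
    increasing H (splice N s b) /\ increasing H (splice N s' b).
Proof.
  intros Is Is'.
  destruct (good_above H (s N) (s' N) G (proj1 Is N) (proj1 Is' N))
    as [y [Hy [K K']]].
  destruct (increasing_from H y G Hy) as [b [Ib Eb]].
  assert (Oy := good_ordinal H y G Hy).
  exists b; split; [exact Ib|]; split; apply increasing_splice; auto;
    intros n Hn; rewrite Eb.
  - exact (ordinal_trans _ _ _ Oy (proj2 Is n N Hn) K).
  - exact (ordinal_trans _ _ _ Oy (proj2 Is' n N Hn) K').
Qed.

Lemma increasing_shift N s : increasing H s -> increasing H (shift N s).
Proof.
  intros Is; apply (increasing_rename H s (fun n => N + n) Is); intros; lia.
Qed.

(** Any two blocks of [N] entries can be compared with a common later one. *)
Lemma shift_invariant {A : Type} (f : env -> A) N :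
  (forall e e', (forall n, n < N -> e n = e' n) -> f e = f e') ->
  (forall s, increasing H s -> f s = f (shift N s)) ->
  forall s s', increasing H s -> increasing H s' -> f s = f s'.
Proof.
  intros HN E s s' Is Is'; destruct (common_tail N s s' Is Is') as [b [_ [I I']]].
  transitivity (f b).
  - rewrite <- (shift_splice N s b), <- E by exact I; apply HN.
    intros n Hn; symmetry; now apply splice_lt.
  - rewrite <- (shift_splice N s' b), <- E by exact I'; apply HN.
    intros n Hn; now apply splice_lt.
Qed.

(** Three truth values cannot be pairwise different, and any two of three
    consecutive blocks of [N] entries begin an increasing sequence. *)
Lemma three_blocks (f : env -> Prop) N :
  (forall e e', (forall n, n < N -> e n = e' n) -> f e <-> f e') ->
  (forall s, increasing H s -> ~ (f s <-> f (shift N s))) ->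
  forall s, ~ increasing H s.
Proof.
  intros HN D s Is.
  set (r := fun n => if n <? N then n else n + N).
  assert (Ir : increasing H (fun n => s (r n))).
  { apply increasing_rename; [exact Is|]; intros a b Hab; unfold r.
    destruct (Nat.ltb_spec a N), (Nat.ltb_spec b N); lia. }
  assert (D1 := D s Is).
  assert (D2 := D (shift N s) (increasing_shift N s Is)).
  assert (D3 := D _ Ir).
  replace (shift N (fun n => s (r n))) with (shift N (shift N s)) in D3.
  - rewrite (HN (fun n => s (r n)) s) in D3.
    + destruct (classic (f s)), (classic (f (shift N s))),
        (classic (f (shift N (shift N s)))); tauto.
    + intros n Hn; unfold r; destruct (Nat.ltb_spec n N); [auto|lia].
  - apply functional_extensionality; intros n; unfold shift, r.
    destruct (Nat.ltb_spec (N + n) N); [lia|]; f_equal; lia.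
Qed.

(** Induction on the rank [rho] of the values, which is constant by
    [regressive_ordinal].  If [f] distinguished two blocks, an element [b] of the
    symmetric difference would be a regressive function of smaller rank, hence
    constant; but membership of a fixed [b] cannot distinguish three values
    pairwise. *)
Lemma regressive_constant f : definable f ->
  (forall s, increasing H s -> f s ∈ R (s 0)) ->
  forall s s', increasing H s -> increasing H s' -> f s = f s'.
Proof.
  assert (Main : forall rho f, definable f ->
    (forall s, increasing H s -> rank (f s) = rho) ->
    (forall s, increasing H s -> f s ∈ R (s 0)) ->
    forall s s', increasing H s -> increasing H s' -> f s = f s').
  { intros rho; induction (mem_wf rho) as [rho _ IH]; clear f; intros f Hf Rk Rg.
    destruct (definable_support f Hf) as [N HN].
    apply (shift_invariant f N HN).
    intros z Iz; apply NNPP; intros Dz.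
    assert (Hsh : definable (fun e => f (shift N e))) by now apply definable_rename.
    assert (Ne := fun z' I' => indiscernible _ z z'
      (definable_not _ (definable_eq _ _ Hf Hsh)) Iz I' Dz); cbv beta in Ne.
    set (K := fun e : env => ~ (e 0 ∈ f (fun n => e (2 * n + 1)) <->
      e 0 ∈ f (fun n => e (2 * (N + n) + 1)))).
    assert (HK : definable_pred K).
    { apply definable_not, definable_iff; apply definable_mem;
        [apply definable_var| |apply definable_var|];
        now apply definable_rename. }
    assert (EK : forall w e,
      K (mix w e) <-> ~ (w 0 ∈ f e <-> w 0 ∈ f (shift N e))).
    { intros w e; unfold K; change (mix w e 0) with (w 0).
      replace (fun n => mix w e (2 * n + 1)) with e;
        [replace (fun n => mix w e (2 * (N + n) + 1)) with (shift N e);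
          [reflexivity|]|];
        apply functional_extensionality; intros n; now rewrite mix_odd. }
    set (b := fun e => choose_env (R (e 0)) (fun w => holds (tv (K (mix w e)))) 0).
    assert (Hb : definable b).
    { apply (definable_eps 0 (fun e => R (e 0)) (fun e => tv (K e)));
        [apply definable_R, definable_var | exact HK]. }
    assert (Bspec : forall s, increasing H s -> b s ∈ R (s 0) /\
      ~ (b s ∈ f s <-> b s ∈ f (shift N s)) /\ rank (b s) ∈ rho).
    { intros s Is.
      assert (Rsh : rank (f (shift N s)) = rho).
      { apply Rk, increasing_shift, Is. }
      assert (Low : forall x, ~ (x ∈ f s <-> x ∈ f (shift N s)) -> rank x ∈ rho).
      { intros x Hx; destruct (classic (x ∈ f s)) as [K1|K1].
        - apply rank_mem in K1; now rewrite Rk in K1.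
        - destruct (classic (x ∈ f (shift N s))) as [K2|K2]; [|tauto].
          apply rank_mem in K2; now rewrite Rsh in K2. }
      assert (Os := good_ordinal H _ G (proj1 Is 0)).
      assert (Rs := Rg s Is); apply (mem_R_rank _ _ Os) in Rs.
      rewrite (Rk s Is) in Rs.
      assert (C : valid_choice (R (s 0)) (fun w => holds (tv (K (mix w s))))
        (choose_env (R (s 0)) (fun w => holds (tv (K (mix w s)))))).
      { apply choose_env_spec.
        destruct (classic (exists x, ~ (x ∈ f s <-> x ∈ f (shift N s))))
          as [[x Hx]|Nx].
        - exists (fun _ => x); split.
          + intros _; apply mem_R_rank; [exact Os|].
            exact (ordinal_trans _ _ _ Os (Low x Hx) Rs).
          + apply holds_tv, (proj2 (EK _ _)), Hx.
        - exfalso; apply (Ne s Is), V_ext; intros x; apply NNPP; intros Hx.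
          apply Nx; now exists x. }
      destruct C as [C1 C2]; apply holds_tv, (proj1 (EK _ _)) in C2.
      split; [apply C1|]; split; [exact C2|]; now apply Low. }
    assert (Bc : forall s s', increasing H s -> increasing H s' -> b s = b s').
    { apply (IH (rank (b z)));
        [apply (Bspec z Iz) | exact Hb | | intros t It; apply (Bspec t It)].
      intros t It; apply (regressive_ordinal (fun e => rank (b e))); auto.
      - now apply definable_rank.
      - intros s Is; apply mem_R_rank; [|now apply Bspec].
        exact (good_ordinal H _ G (proj1 Is 0)). }
    apply (three_blocks (fun s => b z ∈ f s) N) with z; [| |exact Iz].
    - intros e e' E; now rewrite (HN e e' E).
    - intros s Is; rewrite (Bc z s Iz Is); now apply Bspec. }
  intros Hf Rg s s' Is Is'; apply (Main (rank (f s))); auto.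
  intros t It; apply (regressive_ordinal (fun e => rank (f e))); auto.
  - now apply definable_rank.
  - intros u Iu; apply mem_R_rank; [|now apply Rg].
    exact (good_ordinal H _ G (proj1 Iu 0)).
Qed.

(** If some parameters distinguished two blocks, choose such parameters [q]
    definably from the blocks.  They are regressive, hence constant, and then
    [three_blocks] applies to them. *)
Lemma indiscernible_over P p s s' : definable_pred P ->
  (forall n, p n ∈ R lam) -> increasing H s -> increasing H s' ->
  (P (mix p s) <-> P (mix p s')).
Proof.
  intros HP; revert p s s'.
  destruct (definable_pred_support _ HP) as [N HN].
  assert (Supp : forall p e e', (forall n, n < N -> e n = e' n) ->
    P (mix p e) <-> P (mix p e')).
  { intros p e e' E; apply HN; intros n Hn; unfold mix.
    destruct (Nat.even n); [reflexivity|]; apply E.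
    assert (K := Nat.div2_odd n); lia. }
  set (r := fun n => if Nat.even n then n else n + 2 * N).
  set (K := fun e : env => ~ (P e <-> P (fun n => e (r n)))).
  assert (HK : definable_pred K).
  { apply definable_not, definable_iff; [exact HP|].
    apply (definable_rename (fun e => tv (P e))), HP. }
  assert (EK : forall w e,
    K (mix w e) <-> ~ (P (mix w e) <-> P (mix w (shift N e)))).
  { intros w e; unfold K; rewrite (mix_comp w e r) with (r := fun n => N + n).
    - reflexivity.
    - intros n; unfold r; now rewrite Nat.even_mul.
    - intros n; unfold r; rewrite Nat.add_1_r, Nat.even_succ, Nat.odd_mul.
      simpl andb; cbv iota; lia. }
  set (q := fun i e => choose_env (R (e 0)) (fun w => holds (tv (K (mix w e)))) i).
  assert (Hq : forall i, definable (q i)).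
  { intros i; apply (definable_eps i (fun e => R (e 0)) (fun e => tv (K e)));
      [apply definable_R, definable_var | exact HK]. }
  assert (Key : forall s, increasing H s -> forall p, (forall n, p n ∈ R (s 0)) ->
    P (mix p s) <-> P (mix p (shift N s))).
  { intros z Iz p Hp; apply NNPP; intros Dz.
    assert (Ex : definable_pred (fun e =>
      exists w, valid_choice (R (e 0)) (fun w => K (mix w e)) w)).
    { apply definable_ex; [apply definable_R, definable_var | exact HK]. }
    assert (Exz := fun s Is => indiscernible _ z s Ex Iz Is
      (ex_intro _ p (conj Hp (proj2 (EK p z) Dz)))); cbv beta in Exz.
    assert (Q : forall s, increasing H s -> (forall i, q i s ∈ R (s 0)) /\
      ~ (P (mix (fun i => q i s) s) <-> P (mix (fun i => q i s) (shift N s)))).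
    { intros s Is; destruct (Exz s Is) as [w [W1 W2]].
      assert (C := choose_env_spec (R (s 0))
        (fun w => holds (tv (K (mix w s))))).
      destruct C as [C1 C2].
      - exists w; split; [exact W1|]; now apply holds_tv.
      - split; [exact C1|]; exact (proj1 (EK _ _) (proj1 (holds_tv _) C2)). }
    assert (Qc : forall i s, increasing H s -> q i s = q i z).
    { intros i s Is; apply regressive_constant; auto.
      intros t It; now apply Q. }
    apply (three_blocks (fun s => P (mix (fun i => q i z) s)) N) with z;
      [apply Supp| |exact Iz].
    intros s Is; destruct (Q s Is) as [_ Qs].
    replace (fun i => q i z) with (fun i => q i s); [exact Qs|].
    apply functional_extensionality; intros i; now apply Qc. }
  intros p s s' Hp Is Is'.
  assert (E : (fun s => tv (P (mix p s))) s = (fun s => tv (P (mix p s))) s').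
  { apply (shift_invariant (fun s => tv (P (mix p s))) N); auto.
    - intros e e' E; now apply tv_ext, Supp.
    - intros t It; apply tv_ext, Key; [exact It|]; intros n.
      apply (R_mono lam); [apply lam_le, It | apply Hp]. }
  rewrite <- (holds_tv (P (mix p s))), <- (holds_tv (P (mix p s'))).
  cbv beta in E; now rewrite E.
Qed.

(** The form used for a single indiscernible: variable [0] is the indiscernible
    and the others are parameters. *)
Lemma indiscernible_over_one P p h h' : definable_pred P ->
  (forall n, p n ∈ R lam) -> H h -> H h' ->
  (P (scons h p) <-> P (scons h' p)).
Proof.
  intros HP Hp Hh Hh'.
  destruct (increasing_from H h G Hh) as [s [Is <-]]; destruct (increasing_from H h' G Hh') as [s' [Is' <-]].
  set (r := fun n => match n with 0 => 1 | S n => 2 * n end).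
  assert (E : forall s, scons (s 0) p = fun n => mix p s (r n)).
  { intros t; apply functional_extensionality; intros [|n]; [reflexivity|].
    unfold r; now rewrite mix_even. }
  rewrite !E; apply (indiscernible_over (fun e => P (fun n => e (r n)))); auto.
  apply (definable_rename (fun e => tv (P e))), HP.
Qed.

(** * The least indiscernible is inaccessible *)

(** Symbols for the domain and the values of a short unbounded map into an
    ordinal that is not regular, for a set whose power set is too large and for
    the well-ordering of power sets, for [omega], and for the predicate of the
    structure on a rank. *)
Definition sym_domain : nat := 0.
Definition sym_map : nat := 1.
Definition sym_power : nat := 2.
Definition sym_enum : nat := 3.
Definition sym_omega : nat := 4.
Definition sym_pred : nat := 5.

(** For a short unbounded map at [lam], the map at any [h] in [H] has the same
    domain and the same values, and so is bounded by [lam] when [lam] is below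
    [h].  The symbol [sym_domain] returns [k] itself at regular [k], which lets a
    term tell whether [h] is regular. *)
Lemma lam_regular :
  (forall k, regular k -> F sym_domain k k = k) ->
  (forall k, ~ regular k -> F sym_domain k k ∈ k /\
    (forall x, x ∈ F sym_domain k k -> F sym_map k x ∈ k) /\
    forall b, b ∈ k -> exists x, x ∈ F sym_domain k k /\ ~ F sym_map k x ∈ b) ->
  regular lam.
Proof.
  intros H0 H1; apply NNPP; intros NR.
  assert (Ol := lam_ordinal).
  destruct (H1 lam NR) as [Ha [Hf _]].
  destruct (good_above H lam lam G Hlam Hlam) as [h [Hh [Lh _]]].
  assert (Rl : forall x, x ∈ lam -> x ∈ R lam) by (intros; now apply ordinal_mem_R).
  set (a := F sym_domain lam lam) in *.
  assert (Eh : F sym_domain h h = a).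
  { apply (indiscernible_over_one (fun e => F sym_domain (e 0) (e 0) = e 1) (fun _ => a)
      lam h); auto.
    apply definable_eq; [apply definable_fun|]; apply definable_var. }
  destruct (H1 h) as [_ [_ Bh]].
  { intros Rh; rewrite (H0 h Rh) in Eh; rewrite <- Eh in Ha.
    exact (Hmin H G h Hh Ha). }
  destruct (Bh lam Lh) as [x [Hx Nx]]; rewrite Eh in Hx; apply Nx.
  assert (Hv := Hf x Hx); set (v := F sym_map lam x) in *.
  replace (F sym_map h x) with v; [exact Hv|]; symmetry.
  apply (indiscernible_over_one (fun e => F sym_map (e 0) (e 1) = e 2)
    (fun n => if n =? 0 then x else v) lam h); [ | |exact Hlam|exact Hh|reflexivity].
  - apply definable_eq; [apply definable_fun|]; apply definable_var.
  - intros n; destruct (n =? 0); apply Rl; auto.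
    exact (ordinal_trans _ _ _ Ol Hx Ha).
Qed.

(** If the power set of some [a] in [lam] is too large at [lam], then it is so at
    every [h] in [H], with the same [a].  Hence every member of [H] indexes a
    subset of [a], and by indiscernibility over [R lam] these subsets are equal
    although the enumeration is injective. *)
Lemma lam_strong_limit :
  (forall k, strong_limit k -> F sym_power k k = k) ->
  (forall k, ~ strong_limit k -> F sym_power k k ∈ k /\
    forall b, b ∈ k -> ~ equinumerous (power (F sym_power k k)) b) ->
  (forall a, exists t, ordinal t /\ (forall x, x ∈ t -> F sym_enum a x ∈ power a) /\
    (forall x y, x ∈ t -> y ∈ t -> F sym_enum a x = F sym_enum a y -> x = y) /\
    forall c, c ∈ power a -> exists x, x ∈ t /\ F sym_enum a x = c) ->
  strong_limit lam.
Proof.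
  intros H2 H2' H3; apply NNPP; intros NS.
  assert (Ol := lam_ordinal).
  destruct (H2' lam NS) as [Ha _].
  assert (Rl : forall x, x ∈ lam -> x ∈ R lam) by (intros; now apply ordinal_mem_R).
  set (a := F sym_power lam lam) in *.
  destruct (H3 a) as [t [Ot [Tt [It St]]]].
  assert (Big : forall h, H h -> h ⊆ t).
  { intros h Hh.
    assert (Eh : F sym_power h h = a).
    { apply (indiscernible_over_one (fun e => F sym_power (e 0) (e 0) = e 1) (fun _ => a)
        lam h); auto.
      apply definable_eq; [apply definable_fun|]; apply definable_var. }
    apply ordinal_not_mem; [exact (good_ordinal H h G Hh) | exact Ot|].
    intros Hth; destruct (H2' h) as [_ N].
    { intros Sh; rewrite (H2 h Sh) in Eh; rewrite <- Eh in Ha.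
      exact (Hmin H G h Hh Ha). }
    apply (N t Hth); rewrite Eh.
    set (g := fun c => epsilon (inhabits empty) (fun x => x ∈ t /\ F sym_enum a x = c)).
    assert (Hg : forall c, c ∈ power a -> g c ∈ t /\ F sym_enum a (g c) = c).
    { intros c Hc; exact (epsilon_spec (inhabits empty) _ (St c Hc)). }
    exists g; split; [|split].
    - intros c Hc; now apply Hg.
    - intros c d Hc Hd E.
      now rewrite <- (proj2 (Hg c Hc)), <- (proj2 (Hg d Hd)), E.
    - intros x Hx; exists (F sym_enum a x); split; [now apply Tt|].
      apply It; [now apply Hg, Tt | exact Hx | now apply Hg, Tt]. }
  destruct (good_above H lam lam G Hlam Hlam) as [h [Hh [Lh _]]].
  destruct (good_above H h h G Hh Hh) as [h' [Hh' [Kh _]]].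
  assert (Tl : lam ∈ t) by exact (Big h Hh lam Lh).
  assert (Th : h ∈ t) by exact (Big h' Hh' h Kh).
  assert (E : F sym_enum a lam = F sym_enum a h).
  { assert (S1 := proj1 (mem_power _ _) (Tt lam Tl)).
    assert (S2 := proj1 (mem_power _ _) (Tt h Th)).
    assert (K : forall x, x ∈ a -> x ∈ F sym_enum a lam <-> x ∈ F sym_enum a h).
    { intros x Hx.
      apply (indiscernible_over_one (fun e => e 1 ∈ F sym_enum (e 2) (e 0))
        (fun n => if n =? 0 then x else a) lam h); auto.
      - apply definable_mem; [|apply definable_fun]; apply definable_var.
      - intros n; destruct (n =? 0); apply Rl; auto.
        exact (ordinal_trans _ _ _ Ol Hx Ha). }
    apply V_ext; intros x; split; intros Hx; apply K; auto. }
  apply It in E; auto; rewrite E in Lh; exact (mem_irrefl _ Lh).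
Qed.

(** Otherwise all members of [H], being indiscernible, would lie in [omega] or be
    equal to it. *)
Lemma lam_above_omega : (forall x y, F sym_omega x y = omega) -> omega ∈ lam.
Proof.
  intros H4.
  assert (Om : definable (fun _ => omega)).
  { apply (definable_ext (fun e => F sym_omega (e 0) (e 0))); [|intros; apply H4].
    apply definable_fun; apply definable_var. }
  destruct (increasing_from H lam G Hlam) as [s [Is Es]].
  destruct (ordinal_tricho lam omega lam_ordinal omega_ordinal) as [L|[L|L]];
    [| |exact L]; exfalso; rewrite <- Es in L.
  - apply (good_uncountable H G).
    apply countable_sub with (fun x => exists n, x = numeral n);
      [apply countable_range|].
    intros x Hx; destruct (increasing_from H x G Hx) as [s' [Is' <-]]; apply mem_omega.
    apply (indiscernible (fun e => e 0 ∈ omega) s s'); auto.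
    apply definable_mem; [apply definable_var | exact Om].
  - destruct (good_above H lam lam G Hlam Hlam) as [h [Hh [Lh _]]].
    destruct (increasing_from H h G Hh) as [s' [Is' <-]].
    rewrite (indiscernible (fun e => e 0 = omega) s s') in Lh; auto.
    + rewrite <- Es, L in Lh; exact (mem_irrefl _ Lh).
    + apply definable_eq; [apply definable_var | exact Om].
Qed.

(** * Stretching the indiscernibles *)

Definition placement (X : V -> Prop) (j : V -> V) : Prop :=
  (forall x, X x -> H (j x)) /\
  forall x y, X x -> X y -> x ∈ y -> j x ∈ j y.

Lemma placement_sub (X Y : V -> Prop) j :
  (forall x, X x -> Y x) -> placement Y j -> placement X j.
Proof. intros S [P1 P2]; split; auto. Qed.

(** Each point goes to the least indiscernible not used before; a countable
    set never exhausts the uncountable class [H]. *)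
Lemma placement_exists X : countable X -> (forall x, X x -> ordinal x) ->
  exists j, placement X j.
Proof.
  intros CX OX.
  set (A := fun (g : V -> V -> Prop) h =>
    H h /\ forall y v, g y v -> X y -> v <> h).
  destruct (mem_recursion (fun _ g => epsilon (inhabits empty)
    (fun h => A g h /\ forall h', h' ∈ h -> ~ A g h'))) as [j Hj].
  set (g := fun x y v => y ∈ x /\ v = j y).
  assert (Sp : forall x, A (g x) (j x) /\ forall h, h ∈ j x -> ~ A (g x) h).
  { intros x; rewrite (Hj x); apply (epsilon_spec (inhabits empty)
      (fun h => A (g x) h /\ forall h', h' ∈ h -> ~ A (g x) h')).
    destruct (classic (exists h, A (g x) h)) as [[h Hh]|Nh].
    - now apply mem_minimal with h.
    - exfalso; apply (good_uncountable H G), (countable_image X _ j CX).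
      intros h Hh; apply NNPP; intros K; apply Nh; exists h; split; [exact Hh|].
      intros y v [_ ->] Hy E; apply K; now exists y. }
  exists j; split; [intros x _; apply Sp|].
  intros x y Hx Hy Hxy.
  assert (Hjx := proj1 (proj1 (Sp x))); assert (Hjy := proj1 (proj1 (Sp y))).
  destruct (ordinal_tricho (j x) (j y) (good_ordinal H _ G Hjx)
    (good_ordinal H _ G Hjy)) as [L|[L|L]]; [exact L| |]; exfalso.
  - exact (proj2 (proj1 (Sp y)) x (j x) (conj Hxy eq_refl) Hx L).
  - apply (proj2 (Sp x) (j y) L); split; [exact Hjy|].
    intros z v [Hz ->] Xz E.
    exact (proj2 (proj1 (Sp y)) z (j z)
      (conj (ordinal_trans _ _ _ (OX y Hy) Hz Hxy) eq_refl) Xz E).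
Qed.

Lemma placement_indiscernible P p y j j' : definable_pred P ->
  (forall n, p n ∈ R lam) -> (forall n, ordinal (y n)) ->
  placement (fun x => exists n, x = y n) j ->
  placement (fun x => exists n, x = y n) j' ->
  (P (mix p (fun n => j (y n))) <-> P (mix p (fun n => j' (y n)))).
Proof.
  intros HP Hp Oy Pj Pj'.
  destruct (definable_pred_support _ HP) as [N HN].
  destruct (sort_sequence y N Oy) as (k & x & rho & E & I & Rx).
  set (r := fun n => if Nat.even n then n else 2 * rho (Nat.div2 n) + 1).
  assert (K : forall j, placement (fun x => exists n, x = y n) j ->
    exists s, increasing H s /\
      (P (mix p (fun n => j (y n))) <-> P (fun n => mix p s (r n)))).
  { clear j j' Pj Pj'; intros j [J1 J2].
    destruct (good_extend H (fun a => j (x a)) k G) as [s [Is Es]].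
    - intros a Ha; apply J1; now apply Rx.
    - intros a b Hab Hb; apply J2; [apply Rx; lia | now apply Rx | now apply I].
    - exists s; split; [exact Is|].
      apply HN.
      intros n Hn; destruct (even_odd_cases n) as [[m ->]|[m ->]]; unfold r.
      + rewrite Nat.even_mul; simpl orb; cbv iota; now rewrite !mix_even.
      + rewrite Nat.add_1_r, Nat.even_succ, Nat.odd_mul; simpl andb; cbv iota.
        rewrite Nat.div2_succ_double, <- Nat.add_1_r, !mix_odd.
        destruct (E m) as [Em <-]; [lia|]; symmetry; auto. }
  destruct (K j Pj) as [s [Is ->]]; destruct (K j' Pj') as [s' [Is' ->]].
  apply (indiscernible_over (fun e => P (fun n => e (r n)))); auto.
  exact (definable_rename (fun e => tv (P e)) r HP).
Qed.

(** The members of [beta] index the stretched indiscernibles, and the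
    model consists of the elements that lie in [R] of the one with index [top]. *)
Section Stretch.

Variables (beta top : V).
Hypotheses (Obeta : ordinal beta) (Htop : top ∈ beta)
  (lam_inhabited : empty ∈ R lam).

(** Names of elements: a term, the values of its even variables in [R lam], and
    the indices of the indiscernibles that replace its odd variables.  Indices
    of members are used in place of the members so that [elt] is small enough to
    index a set. *)
Definition elt : Type := (term * (nat -> index (R lam)) * (nat -> index beta))%type.

Definition val (j : V -> V) (u : elt) : V :=
  match u with (t, p, s) =>
    eval t (mix (fun n => elem (R lam) (p n)) (fun n => j (elem beta (s n))))
  end.

Definition supp (u : elt) (x : V) : Prop :=
  match u with (t, p, s) => exists n, x = elem beta (s n) end.

Lemma supp_beta u x : supp u x -> x ∈ beta.
Proof. destruct u as [[t p] s]; intros [n ->]; apply elem_mem. Qed.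

Lemma supp_countable u : countable (supp u).
Proof. destruct u as [[t p] s]; apply countable_range. Qed.

Lemma val_transfer u j j' : placement (supp u) j -> placement (supp u) j' ->
  holds (val j u) -> holds (val j' u).
Proof.
  destruct u as [[t p] s]; intros Pj Pj'; simpl.
  apply (placement_indiscernible (fun e => holds (eval t e))
    (fun n => elem (R lam) (p n)) (fun n => elem beta (s n))); auto.
  - apply definable_holds; now exists t.
  - intros n; apply elem_mem.
  - intros n; exact (ordinal_mem _ _ Obeta (elem_mem _ _)).
Qed.

(** The parameters and the indices of countably many names are merged into single
    sequences by pairing. *)
Lemma compose f (us : nat -> elt) : definable f ->
  exists w, (forall j, val j w = f (fun n => val j (us n))) /\
    forall x, supp w x -> exists n, supp (us n) x.
Proof.
  intros Hf.
  set (r := fun n m => if Nat.even m then 2 * to_nat (n, Nat.div2 m)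
    else 2 * to_nat (n, Nat.div2 m) + 1).
  destruct (definable_subst f
    (fun n e => eval (fst (fst (us n))) (fun m => e (r n m))) Hf) as [t Ht].
  { intros n; apply definable_rename; now exists (fst (fst (us n))). }
  exists (t, fun k => snd (fst (us (fst (of_nat k)))) (snd (of_nat k)),
    fun k => snd (us (fst (of_nat k))) (snd (of_nat k))); split.
  - intros j; simpl; rewrite Ht; f_equal; apply functional_extensionality.
    intros n; unfold val; destruct (us n) as [[tn pn] sn] eqn:En; simpl.
    f_equal; apply functional_extensionality; intros m; unfold r.
    unfold mix at 2; destruct (Nat.even m).
    + rewrite mix_even, cancel_of_to; cbn [fst snd]; now rewrite En.
    + rewrite mix_odd, cancel_of_to; cbn [fst snd]; now rewrite En.
  - intros x [k ->]; exists (fst (of_nat k)).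
    destruct (us (fst (of_nat k))) as [[tn pn] sn]; simpl; eauto.
Qed.

(** Truth for all placements of a large enough countable set of indices: a
    countably complete filter that decides every definable property. *)
Definition ev (Phi : (V -> V) -> Prop) : Prop :=
  exists X, countable X /\ (forall x, X x -> x ∈ beta) /\
    forall j, placement X j -> Phi j.

Lemma ev_mono (Phi Psi : (V -> V) -> Prop) :
  ev Phi -> (forall j, Phi j -> Psi j) -> ev Psi.
Proof. intros (X & C & B & HX) K; exists X; auto. Qed.

Lemma ev_all (Phi : nat -> (V -> V) -> Prop) :
  (forall n, ev (Phi n)) -> ev (fun j => forall n, Phi n j).
Proof.
  intros K; destruct (choice _ K) as [X HX].
  exists (fun x => exists n, X n x); split; [|split].
  - apply countable_union; intros n; apply HX.
  - intros x [n Hn]; now apply (proj1 (proj2 (HX n))).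
  - intros j Pj n; apply (proj2 (proj2 (HX n))).
    apply (placement_sub _ _ j (fun x Hx => ex_intro _ n Hx) Pj).
Qed.

Lemma ev_and Phi Psi : ev Phi -> ev Psi -> ev (fun j => Phi j /\ Psi j).
Proof.
  intros K1 K2; apply (ev_mono (fun j => forall n,
    match n with 0 => Phi j | S _ => Psi j end)).
  - apply (ev_all (fun n j => match n with 0 => Phi j | S _ => Psi j end)).
    intros [|n]; assumption.
  - intros j K; split; [exact (K 0) | exact (K 1)].
Qed.

Lemma ev_ex Phi : ev Phi -> exists j, Phi j.
Proof.
  intros (X & C & B & HX); destruct (placement_exists X C) as [j Pj].
  - intros x Hx; exact (ordinal_mem _ _ Obeta (B x Hx)).
  - exists j; auto.
Qed.

Lemma ev_top : ev (fun j => H (j top)).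
Proof.
  exists (fun x => exists n : nat, x = top); split.
  - exact (countable_range (fun _ => top)).
  - split; [intros x [_ ->]; exact Htop|]; intros j [J _]; apply J; now exists 0.
Qed.

Lemma ev_decide P (us : nat -> elt) : definable_pred P ->
  ~ ev (fun j => P (fun n => val j (us n))) ->
  ev (fun j => ~ P (fun n => val j (us n))).
Proof.
  intros HP N; destruct (compose _ us HP) as [w [Ew _]].
  exists (supp w); split; [apply supp_countable|]; split; [apply supp_beta|].
  intros j Pj K; apply N.
  exists (supp w); split; [apply supp_countable|]; split; [apply supp_beta|].
  intros j' Pj'; apply holds_tv; rewrite <- Ew; apply (val_transfer w j); auto.
  rewrite Ew; now apply holds_tv.
Qed.


Lemma par_exists a : a ∈ R lam -> exists u, (forall j, val j u = a) /\
  forall x, supp u x -> x = top.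
Proof.
  intros [i <-]; destruct Htop as [k Ek].
  exists (TVar 0, fun _ => i, fun _ => k); split; [reflexivity|].
  intros x [n ->]; exact Ek.
Qed.

Lemma idx_exists x : x ∈ beta -> exists u, forall j, val j u = j x.
Proof.
  intros [k <-]; destruct lam_inhabited as [i _].
  now exists (TVar 1, fun _ => i, fun _ => k).
Qed.

Definition ev_mem (u v : elt) : Prop := ev (fun j => val j u ∈ val j v).
Definition ev_eq (u v : elt) : Prop := ev (fun j => val j u = val j v).
(** The model lives below the topmost indiscernible. *)
Definition inside (u : elt) : Prop := ev (fun j => val j u ∈ R (j top)).

Definition pair_env {A : Type} (u v : A) (n : nat) : A :=
  match n with 0 => u | _ => v end.

Lemma ev_mem_decide u v : ~ ev_mem u v -> ev (fun j => ~ val j u ∈ val j v).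
Proof.
  apply (ev_decide (fun e => e 0 ∈ e 1) (pair_env u v)).
  apply definable_mem; apply definable_var.
Qed.

Lemma ev_eq_decide u v : ~ ev_eq u v -> ev (fun j => val j u <> val j v).
Proof.
  apply (ev_decide (fun e => e 0 = e 1) (pair_env u v)).
  apply definable_eq; apply definable_var.
Qed.

Lemma inside_mem u v : inside v -> ev_mem u v -> inside u.
Proof.
  intros Hv Huv; apply (ev_mono _ _ (ev_and _ _ Hv Huv)); intros j [K1 K2].
  exact (R_transitive _ _ K1 _ K2).
Qed.

(** A descending sequence involves countably many indices, so one placement
    turns it into a descending sequence of sets. *)
Lemma ev_mem_wf : well_founded ev_mem.
Proof.
  apply no_descending_wf; intros d K.
  destruct (ev_ex _ (ev_all _ K)) as [j Hj].
  exact (no_descending (fun n => val j (d n)) Hj).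
Qed.

Definition collapse : elt -> V :=
  Fix ev_mem_wf (fun _ => V) (fun u rec =>
    set_of {v | ev_mem v u} (fun v => rec (proj1_sig v) (proj2_sig v))).

Lemma mem_collapse z u :
  z ∈ collapse u <-> exists v, ev_mem v u /\ collapse v = z.
Proof.
  unfold collapse; rewrite Fix_eq; fold collapse.
  - rewrite mem_set_of; split.
    + intros [[v Hv] E]; now exists v.
    + intros [v [Hv E]]; now exists (exist _ v Hv).
  - intros x f g E; f_equal; apply functional_extensionality; intros [v Hv].
    apply E.
Qed.

Lemma collapse_eq u v : ev_eq u v -> collapse u = collapse v.
Proof.
  intros E; apply V_ext; intros z; rewrite !mem_collapse.
  split; intros [w [Hw Ew]]; exists w; split; auto;
    apply (ev_mono _ _ (ev_and _ _ E Hw)); intros j [K1 K2]; congruence.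
Qed.

(** A member of the symmetric difference of two distinct values is chosen by a
    term and therefore has a name; this makes the membership relation
    extensional, as its collapse requires. *)
Lemma separate u v : inside u -> inside v -> ~ ev_eq u v ->
  exists w, (ev_mem w u /\ ~ ev_mem w v) \/ (ev_mem w v /\ ~ ev_mem w u).
Proof.
  intros Iu Iv N; apply ev_eq_decide in N.
  destruct (idx_exists top Htop) as [t Et].
  set (P := fun e : env => ~ (e 0 ∈ e 1 <-> e 0 ∈ e 3)).
  assert (HP : definable_pred P).
  { apply definable_not, definable_iff; apply definable_mem; apply definable_var. }
  destruct (compose (fun e => choose_env (R (e 2))
      (fun w => holds (tv (P (mix w e)))) 0)
    (fun n => match n with 0 => u | 1 => v | _ => t end)) as [w [Ew _]].
  { apply (definable_eps 0 (fun e => R (e 2)) (fun e => tv (P e)));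
      [apply definable_R, definable_var | exact HP]. }
  assert (D : ev (fun j => ~ (val j w ∈ val j u <-> val j w ∈ val j v))).
  { apply (ev_mono _ _ (ev_and _ _ N (ev_and _ _ Iu Iv))).
    intros j [Nj [Ij Ij']].
    assert (E : exists x, ~ (x ∈ val j u <-> x ∈ val j v)).
    { apply NNPP; intros K; apply Nj, V_ext; intros x; apply NNPP; intros Kx.
      apply K; now exists x. }
    destruct E as [x Hx]; rewrite Ew, Et.
    set (e := fun n => val j match n with 0 => u | 1 => v | _ => t end).
    destruct (choose_env_spec (R (j top)) (fun w => holds (tv (P (mix w e)))))
      as [_ C].
    - exists (fun _ => x); split; [|now apply holds_tv].
      intros _; destruct (classic (x ∈ val j u)) as [Xu|Xu].
      + exact (R_transitive _ _ Ij _ Xu).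
      + destruct (classic (x ∈ val j v)) as [Xv|Xv]; [|tauto].
        exact (R_transitive _ _ Ij' _ Xv).
    - exact (proj1 (holds_tv _) C). }
  exists w; destruct (classic (ev_mem w u)) as [Mu|Mu];
    destruct (classic (ev_mem w v)) as [Mv|Mv]; auto; exfalso.
  - destruct (ev_ex _ (ev_and _ _ D (ev_and _ _ Mu Mv))) as [j Hj]; tauto.
  - apply ev_mem_decide in Mu; apply ev_mem_decide in Mv.
    destruct (ev_ex _ (ev_and _ _ D (ev_and _ _ Mu Mv))) as [j Hj]; tauto.
Qed.

Lemma collapse_inj u v :
  inside u -> inside v -> collapse u = collapse v -> ev_eq u v.
Proof.
  revert v; induction (ev_mem_wf u) as [u _ IH]; intros v Iu Iv E.
  apply NNPP; intros N.
  destruct (separate u v Iu Iv N) as [w [[Wu Wv]|[Wv Wu]]].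
  - assert (K : collapse w ∈ collapse u) by (apply mem_collapse; now exists w).
    rewrite E in K; apply mem_collapse in K; destruct K as [w' [W' E']].
    apply Wv; assert (Q : ev_eq w w').
    { apply (IH w Wu); auto; [now apply (inside_mem w u)|].
      now apply (inside_mem w' v). }
    apply (ev_mono _ _ (ev_and _ _ Q W')); intros j [-> K]; exact K.
  - assert (K : collapse w ∈ collapse v) by (apply mem_collapse; now exists w).
    rewrite <- E in K; apply mem_collapse in K; destruct K as [w' [W' E']].
    apply Wu; assert (Q : ev_eq w' w).
    { apply (IH w' W'); auto; [now apply (inside_mem w' u)|].
      now apply (inside_mem w v). }
    apply (ev_mono _ _ (ev_and _ _ Q W')); intros j [<- K]; exact K.
Qed.

Lemma collapse_mem u v :
  inside u -> inside v -> (collapse u ∈ collapse v <-> ev_mem u v).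
Proof.
  intros Iu Iv; rewrite mem_collapse; split; [|intros K; now exists u].
  intros [w [Wv E]]; apply collapse_inj in E; auto; [|now apply (inside_mem w v)].
  apply (ev_mono _ _ (ev_and _ _ E Wv)); intros j [<- K]; exact K.
Qed.

(** Since membership between names is well-founded and extensional, the model is
    taken to be its transitive collapse, with the predicate that the language
    attaches to the topmost indiscernible. *)
Definition stretched : structure :=
  Structure (set_of {u | inside u} (fun u => collapse (proj1_sig u))) mem
    (fun x => exists u, inside u /\ collapse u = x /\
      ev (fun j => val j u ∈ F sym_pred (j top) (j top))).

Lemma dom_stretched x :
  x ∈ dom stretched <-> exists u, inside u /\ collapse u = x.
Proof.
  simpl; rewrite mem_set_of; split.
  - intros [[u Iu] E]; now exists u.
  - intros [u [Iu E]]; now exists (exist _ u Iu).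
Qed.

Lemma dom_stretched_transitive : transitive (dom stretched).
Proof.
  intros y Hy z Hz; apply dom_stretched in Hy; destruct Hy as [u [Iu <-]].
  apply mem_collapse in Hz; destruct Hz as [v [Hv <-]].
  apply dom_stretched; exists v; split; [now apply (inside_mem v u)|reflexivity].
Qed.

Definition sat_in_R (p : formula) (e : env) : Prop :=
  sat (R_structure (e 0) (F sym_pred (e 0) (e 0))) (fun n => e (S n)) p.

(** Moves the bound variable of an existential formula to position 1, behind
    the ordinal that determines the structure. *)
Definition ex_rename (n : nat) : nat :=
  match n with 0 => 1 | 1 => 0 | S (S n) => 2 * S n + 1 end.

Definition ex_body (p : formula) (e : env) : Prop :=
  sat_in_R p (fun n => e (ex_rename n)).

Lemma ex_body_mix p w e : ex_body p (mix w e) <->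
  sat (R_structure (e 0) (F sym_pred (e 0) (e 0))) (scons (w 0) (fun n => e (S n))) p.
Proof.
  unfold ex_body, sat_in_R; change (mix w e (ex_rename 0)) with (e 0).
  replace (fun n => mix w e (ex_rename (S n))) with
    (scons (w 0) (fun n => e (S n))); [reflexivity|].
  apply functional_extensionality; intros [|n]; [reflexivity|].
  unfold ex_rename; now rewrite mix_odd.
Qed.

Lemma definable_ex_body p :
  definable_pred (sat_in_R p) -> definable_pred (ex_body p).
Proof. exact (definable_rename (fun e => tv (sat_in_R p e)) ex_rename). Qed.

Lemma definable_sat p : definable_pred (sat_in_R p).
Proof.
  induction p as [i j|i j|i|p IH|p IHp q IHq|p IH].
  - apply definable_eq; apply definable_var.
  - apply definable_mem; apply definable_var.
  - apply definable_mem; [|apply definable_fun]; apply definable_var.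
  - exact (definable_not _ IH).
  - exact (definable_and _ _ IHp IHq).
  - apply (definable_pred_ext (fun e => exists w, valid_choice (R (e 0))
      (fun w => ex_body p (mix w e)) w)).
    + apply (definable_ex (fun e => R (e 0)) (ex_body p));
        [apply definable_R, definable_var | now apply definable_ex_body].
    + intros e; split.
      * intros [w [W1 W2]]; apply (proj1 (ex_body_mix _ _ _)) in W2.
        exists (w 0); split; [apply W1 | exact W2].
      * intros [a [Ha Sa]]; exists (fun _ => a); split; [auto|].
        apply ex_body_mix; exact Sa.
Qed.

Definition sat_at (j : V -> V) (us : nat -> elt) (p : formula) : Prop :=
  sat (R_structure (j top) (F sym_pred (j top) (j top))) (fun n => val j (us n)) p.

Definition cons_elt (u : elt) (us : nat -> elt) (n : nat) : elt :=
  match n with 0 => u | S n => us n end.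

Lemma sat_at_cons j u us p : sat_at j (cons_elt u us) p =
  sat (R_structure (j top) (F sym_pred (j top) (j top)))
    (scons (val j u) (fun n => val j (us n))) p.
Proof.
  unfold sat_at; f_equal; apply functional_extensionality; now intros [|n].
Qed.

Lemma sat_at_decide us p :
  ~ ev (fun j => sat_at j us p) -> ev (fun j => ~ sat_at j us p).
Proof.
  destruct (idx_exists top Htop) as [t Et]; intros N.
  assert (E : forall j,
    sat_in_R p (fun n => val j (cons_elt t us n)) = sat_at j us p).
  { intros j; unfold sat_in_R; cbn [cons_elt]; now rewrite Et. }
  assert (K := ev_decide (sat_in_R p) (cons_elt t us) (definable_sat p)).
  apply (ev_mono (fun j => ~ sat_in_R p (fun n => val j (cons_elt t us n)))).
  - apply K; intros K'; apply N, (ev_mono _ _ K'); intros j; now rewrite E.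
  - intros j; now rewrite E.
Qed.

(** The theorem of Los for the filter [ev]: negation uses that [ev] decides
    definable properties, and the existential step uses a named witness. *)
Lemma sat_stretched p : forall us, (forall n, inside (us n)) ->
  (sat stretched (fun n => collapse (us n)) p <-> ev (fun j => sat_at j us p)).
Proof.
  induction p as [i k|i k|i|p IH|p IHp q IHq|p IH]; intros us Iu.
  - split; [apply collapse_inj; auto | apply collapse_eq].
  - apply collapse_mem; auto.
  - simpl; split.
    + intros [u [Hu [E K]]]; apply collapse_inj in E; auto.
      apply (ev_mono _ _ (ev_and _ _ E K)); intros j [E' K'].
      unfold sat_at; simpl; now rewrite <- E'.
    + intros K; exists (us i); auto.
  - simpl; rewrite IH by exact Iu; split.
    + apply sat_at_decide.
    + intros K K'; destruct (ev_ex _ (ev_and _ _ K K')) as [j [J J']].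
      exact (J J').
  - simpl; rewrite IHp, IHq by exact Iu; split.
    + intros [K1 K2]; exact (ev_and _ _ K1 K2).
    + intros K; split; apply (ev_mono _ _ K); intros j J; apply J.
  - assert (Cons : forall u, (fun n => collapse (cons_elt u us n)) =
      scons (collapse u) (fun n => collapse (us n))).
    { intros u; apply functional_extensionality; now intros [|n]. }
    assert (Icons : forall u, inside u -> forall n, inside (cons_elt u us n)).
    { intros u Hu [|n]; [exact Hu | apply Iu]. }
    split.
    + intros [a [Ha Sa]]; apply dom_stretched in Ha; destruct Ha as [u [Hu <-]].
      rewrite <- Cons in Sa; apply IH in Sa; [|now apply Icons].
      apply (ev_mono _ _ (ev_and _ _ Hu Sa)); intros j [K1 K2].
      rewrite sat_at_cons in K2; now exists (val j u).
    + intros K; destruct (idx_exists top Htop) as [t Et].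
      destruct (compose (fun e => choose_env (R (e 0))
          (fun w => holds (tv (ex_body p (mix w e)))) 0) (cons_elt t us))
        as [w [Ew _]].
      { apply (definable_eps 0 (fun e => R (e 0)) (fun e => tv (ex_body p e)));
          [apply definable_R, definable_var|].
        apply definable_ex_body, definable_sat. }
      assert (Q : ev (fun j => val j w ∈ R (j top) /\
        sat_at j (cons_elt w us) p)).
      { apply (ev_mono _ _ K); intros j [a [Ha Sa]].
        rewrite sat_at_cons, Ew; cbn [cons_elt]; rewrite Et.
        set (e := fun n => val j match n with 0 => t | S n => us n end).
        assert (E0 : e 0 = j top) by apply Et.
        destruct (choose_env_spec (R (j top))
          (fun w => holds (tv (ex_body p (mix w e))))) as [C1 C2].
        - exists (fun _ => a); split; [auto|]; apply holds_tv, ex_body_mix.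
          rewrite E0; exact Sa.
        - split; [apply C1|]; apply holds_tv, (proj1 (ex_body_mix _ _ _)) in C2.
          rewrite E0 in C2; exact C2. }
      assert (Iw : inside w) by (apply (ev_mono _ _ Q); tauto).
      exists (collapse w); split; [apply dom_stretched; now exists w|].
      rewrite <- Cons; apply IH; [now apply Icons|].
      apply (ev_mono _ _ Q); tauto.
Qed.

Lemma placed_ge x : x ∈ beta -> ev (fun j => lam ⊆ j x).
Proof.
  intros Hx; exists (fun y => exists n : nat, y = x); split; [|split].
  - exact (countable_range (fun _ => x)).
  - now intros y [_ ->].
  - intros j [J _]; apply lam_le, J; now exists 0.
Qed.

Lemma par_inside a u : a ∈ R lam -> (forall j, val j u = a) -> inside u.
Proof.
  intros Ha Eu; apply (ev_mono _ _ (placed_ge top Htop)); intros j L.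
  rewrite Eu; exact (R_mono _ _ L a Ha).
Qed.

(** An element of the model below [a] takes a value in [a] at one placement,
    and by indiscernibility over [R lam] it keeps this value at all others. *)
Lemma ev_below a u : a ∈ R lam -> ev (fun j => val j u ∈ a) ->
  exists b, b ∈ a /\ ev (fun j => val j u = b).
Proof.
  intros Ha K; set (X := fun x => supp u x \/ exists n : nat, x = top).
  assert (CX : countable X).
  { apply countable_or; [apply supp_countable | exact (countable_range (fun _ => top))]. }
  assert (BX : forall x, X x -> x ∈ beta).
  { intros x [Hx|[_ ->]]; [exact (supp_beta u x Hx) | exact Htop]. }
  assert (EX : ev (placement X)) by (exists X; auto).
  destruct (ev_ex _ (ev_and _ _ K EX)) as [j0 [K0 P0]].
  exists (val j0 u); split; [exact K0|].
  destruct (par_exists (val j0 u) (R_transitive _ _ Ha _ K0)) as [v [Ev Sv]].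
  destruct (compose (fun e => tv (e 0 = e 1)) (pair_env u v)) as [w [Ew Sw]].
  { apply definable_eq; apply definable_var. }
  assert (Sub : forall x, supp w x -> X x).
  { intros x Hx; destruct (Sw x Hx) as [[|n] Hn]; [now left|].
    right; exists 0; now apply Sv. }
  apply (ev_mono _ _ EX); intros j Pj.
  assert (Ew' : forall j, val j w = tv (val j u = val j v)) by exact Ew.
  rewrite <- (Ev j); apply holds_tv; rewrite <- Ew'; apply (val_transfer w j0); try exact (placement_sub _ _ _ Sub Pj).
  - exact (placement_sub _ _ _ Sub P0).
  - rewrite Ew'; apply holds_tv; symmetry; apply Ev.
Qed.

(** By [ev_below] nothing is added below the members of [R lam], so the collapse
    leaves them in place. *)
Lemma collapse_par a u : a ∈ R lam -> (forall j, val j u = a) -> collapse u = a.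
Proof.
  revert u; induction (mem_wf a) as [a _ IH]; intros u Ha Eu.
  apply V_ext; intros z; rewrite mem_collapse; split.
  - intros [v [Hv <-]].
    destruct (ev_below a v Ha) as [b [Hb Eb]].
    { apply (ev_mono _ _ Hv); intros j; now rewrite Eu. }
    assert (Rb := R_transitive _ _ Ha _ Hb).
    destruct (par_exists b Rb) as [w [Ew _]].
    rewrite (collapse_eq v w); [now rewrite (IH b Hb w Rb Ew)|].
    apply (ev_mono _ _ Eb); intros j; now rewrite Ew.
  - intros Hz; assert (Rz := R_transitive _ _ Ha _ Hz).
    destruct (par_exists z Rz) as [w [Ew _]].
    exists w; split; [|exact (IH z Hz w Rz Ew)].
    exists (fun _ => False); split; [|split; [contradiction|]].
    + exists (fun _ => 0); contradiction.
    + intros j _; now rewrite Ew, Eu.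
Qed.

Lemma R_lam_dom a : a ∈ R lam -> a ∈ dom stretched.
Proof.
  intros Ha; destruct (par_exists a Ha) as [u [Eu _]].
  apply dom_stretched; exists u; split; [exact (par_inside a u Ha Eu)|].
  exact (collapse_par a u Ha Eu).
Qed.

(** Truth in the model is truth in [R h] for a placed [h], and [R lam] agrees with
    [R h] about parameters from [R lam] as [lam] and [h] are indiscernible. *)
Lemma stretched_elementary :
  elementary_extension (R_structure lam (F sym_pred lam lam)) stretched.
Proof.
  split; [exact R_lam_dom|]; intros p e He; simpl in He.
  destruct (choice _ (fun n => par_exists (e n) (He n))) as [us Hus].
  replace e with (fun n => collapse (us n)) at 2.
  2: { apply functional_extensionality; intros n.
       apply collapse_par; [apply He | apply Hus]. }
  rewrite sat_stretched by (intros n; apply (par_inside (e n)); [apply He | apply Hus]).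
  assert (E : ev (fun j => sat_at j us p <-> sat (R_structure lam (F sym_pred lam lam)) e p)).
  { apply (ev_mono _ _ ev_top); intros j Hj; unfold sat_at.
    replace (fun n => val j (us n)) with e
      by (apply functional_extensionality; intros n; symmetry; apply Hus).
    exact (indiscernible_over_one (sat_in_R p) e (j top) lam
      (definable_sat p) He Hj Hlam). }
  split.
  - intros S; apply (ev_mono _ _ E); tauto.
  - intros K; destruct (ev_ex _ (ev_and _ _ E K)) as [j Hj]; tauto.
Qed.

Lemma collapse_ordinal u : inside u -> ev (fun j => ordinal (val j u)) ->
  ordinal (collapse u).
Proof.
  intros Iu Ou; split.
  - intros y Hy z Hz; apply mem_collapse in Hy; destruct Hy as [v [Hv <-]].
    apply mem_collapse in Hz; destruct Hz as [w [Hw <-]].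
    apply mem_collapse; exists w; split; [|reflexivity].
    apply (ev_mono _ _ (ev_and _ _ Ou (ev_and _ _ Hv Hw))).
    intros j [K1 [K2 K3]]; exact (ordinal_trans _ _ _ K1 K3 K2).
  - intros x y Hx Hy; apply mem_collapse in Hx; destruct Hx as [v [Hv <-]].
    apply mem_collapse in Hy; destruct Hy as [w [Hw <-]].
    assert (Iv := inside_mem v u Iu Hv); assert (Iw := inside_mem w u Iu Hw).
    destruct (classic (ev_mem v w)) as [N1|N1]; [left; now apply collapse_mem|].
    destruct (classic (ev_eq v w)) as [N2|N2];
      [right; left; now apply collapse_eq|].
    destruct (classic (ev_mem w v)) as [N3|N3];
      [right; right; now apply collapse_mem|]; exfalso.
    apply ev_mem_decide in N1; apply ev_eq_decide in N2; apply ev_mem_decide in N3.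
    destruct (ev_ex _ (ev_and _ _ (ev_and _ _ Ou (ev_and _ _ Hv Hw))
      (ev_and _ _ N1 (ev_and _ _ N2 N3)))) as [j [[Oj [Vj Wj]] Nj]].
    destruct (proj2 Oj _ _ Vj Wj) as [K|[K|K]]; tauto.
Qed.

Lemma placed_mem x y : x ∈ beta -> y ∈ beta -> x ∈ y -> ev (fun j => j x ∈ j y).
Proof.
  intros Hx Hy Hxy; exists (fun z => z = x \/ z = y); split; [|split].
  - apply countable_or; exists (fun _ => 0); congruence.
  - intros z [->| ->]; auto.
  - intros j [_ J]; apply J; auto.
Qed.

Lemma placed_ordinal x : x ∈ beta -> ev (fun j => ordinal (j x)).
Proof.
  intros Hx; exists (fun y => y = x); split; [|split].
  - exists (fun _ => 0); congruence.
  - now intros y ->.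
  - intros j [J _]; exact (good_ordinal H _ G (J x eq_refl)).
Qed.

(** Collapsing preserves the order of the indices, so the indiscernible with
    index [x] collapses to an ordinal that is at least [x]; it is new because
    its placements are at least [lam]. *)
Lemma index_in_model x : x ∈ top ->
  x ∈ dom stretched /\ exists y, y ∈ dom stretched /\ ~ y ∈ R lam.
Proof.
  assert (Tb : forall y, y ∈ top -> y ∈ beta).
  { intros y Hy; exact (ordinal_trans _ _ _ Obeta Hy Htop). }
  assert (Ix : forall y u, y ∈ top -> (forall j, val j u = j y) -> inside u).
  { intros y u Hy Eu.
    apply (ev_mono _ _ (ev_and _ _ (placed_mem y top (Tb y Hy) Htop Hy)
      (placed_ordinal top Htop))); intros j [K1 K2].
    rewrite Eu; now apply ordinal_mem_R. }
  assert (Ord : forall y u, y ∈ top -> (forall j, val j u = j y) ->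
    ordinal (collapse u)).
  { intros y u Hy Eu; apply collapse_ordinal; [now apply (Ix y)|].
    apply (ev_mono _ _ (placed_ordinal y (Tb y Hy))); intros j; now rewrite Eu. }
  intros Hx; destruct (idx_exists x (Tb x Hx)) as [u Eu].
  assert (Du : collapse u ∈ dom stretched).
  { apply dom_stretched; exists u; split; [now apply (Ix x) | reflexivity]. }
  split.
  - assert (Low : forall y, y ∈ top -> forall v, (forall j, val j v = j y) ->
      ~ collapse v ∈ y).
    { intros y; induction (mem_wf y) as [y _ IH]; intros Hy v Ev L.
      assert (Oy := ordinal_mem _ _ Obeta (Tb y Hy)).
      assert (Lt : collapse v ∈ top)
        by exact (ordinal_trans _ _ _ (ordinal_mem _ _ Obeta Htop) L Hy).
      destruct (idx_exists _ (Tb _ Lt)) as [w Ew].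
      apply (IH _ L Lt w Ew); apply collapse_mem;
        [now apply (Ix _ w Lt) | now apply (Ix y)|].
      apply (ev_mono _ _ (placed_mem _ y (Tb _ Lt) (Tb y Hy) L)).
      intros j; now rewrite Ew, Ev. }
    destruct (ordinal_tricho (collapse u) x (Ord x u Hx Eu)
      (ordinal_mem _ _ Obeta (Tb x Hx))) as [L|[L|L]].
    + now apply Low in L.
    + now rewrite <- L.
    + exact (dom_stretched_transitive _ Du _ L).
  - exists (collapse u); split; [exact Du|]; intros Ra.
    destruct (par_exists _ Ra) as [v [Ev _]].
    assert (E : ev_eq u v).
    { apply collapse_inj; [now apply (Ix x) | now apply (par_inside _ v Ra)|].
      symmetry; now apply collapse_par. }
    destruct (ev_ex _ (ev_and _ _ E (ev_and _ _ (placed_ge x (Tb x Hx))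
      (placed_ordinal x (Tb x Hx))))) as [j [E' [L Oj]]].
    rewrite Eu, Ev in E'; apply mem_R_rank in Ra; [|exact lam_ordinal].
    rewrite <- E', rank_ordinal_id in Ra by exact Oj.
    exact (mem_irrefl _ (L _ Ra)).
Qed.

Lemma stretched_height :
  exists h, ordinal_height stretched h /\
    forall x, ordinal x -> x ∈ top -> x ∈ h.
Proof.
  exists (set_of {u | inside u /\ ordinal (collapse u)}
    (fun u => collapse (proj1_sig u))).
  assert (M : forall b, b ∈ set_of {u | inside u /\ ordinal (collapse u)}
    (fun u => collapse (proj1_sig u)) <-> ordinal b /\ b ∈ dom stretched).
  { intros b; rewrite mem_set_of, dom_stretched; split.
    - intros [[u [Iu Ou]] <-]; split; [exact Ou | now exists u].
    - intros [Ob [u [Iu <-]]]; now exists (exist _ u (conj Iu Ob)). }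
  split.
  - exists (fun x => x); split.
    + intros x Hx z; split; [|now intros [y [_ [K <-]]]].
      intros Hz; exists z; split; [|split; [exact Hz | reflexivity]].
      exact (dom_stretched_transitive x Hx z Hz).
    + intros b; rewrite M; split.
      * intros [Ob Db]; split; [exact Ob|]; now exists b.
      * intros [Ob [x [Dx <-]]]; now split.
  - intros x Ox Hx; apply M; split; [exact Ox|]; now apply index_in_model.
Qed.

Lemma stretched_end_extension : (exists x, x ∈ top) ->
  end_elementary_extension (R_structure lam (F sym_pred lam lam)) stretched.
Proof.
  intros [x Hx]; split; [exact stretched_elementary|]; split.
  - intros E; destruct (index_in_model x Hx) as [_ [y [Dy Ny]]].
    rewrite <- E in Dy; exact (Ny Dy).
  - intros a Ha b; split; intros [Hb K]; split; auto.
    + now apply R_lam_dom.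
    + exact (R_transitive _ _ Ha _ K).
Qed.

End Stretch.

Lemma arbitrarily_high_extensions alpha : omega ∈ lam -> ordinal alpha ->
  exists M h, end_elementary_extension (R_structure lam (F sym_pred lam lam)) M /\
    well_founded_structure M /\ ordinal_height M h /\ alpha ⊆ h.
Proof.
  intros Hw Oa.
  set (top := succ alpha); set (beta := succ top).
  assert (Ot : ordinal top) by now apply succ_ordinal.
  assert (Ob : ordinal beta) by now apply succ_ordinal.
  assert (Tb : top ∈ beta) by (apply mem_succ; now right).
  assert (E0 : empty ∈ R lam).
  { apply mem_R; exists omega; split; [exact Hw|]; intros z Hz.
    now apply not_mem_empty in Hz. }
  destruct (stretched_height beta top Ob Tb E0) as [h [Hh Hc]].
  exists (stretched beta top Ob), h; split; [|split; [|split]].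
  - apply stretched_end_extension; [exact Tb | exact E0|].
    exists alpha; apply mem_succ; now right.
  - intros x; induction (mem_wf x) as [x _ IH]; constructor.
    intros y [_ [_ Hy]]; exact (IH y Hy).
  - exact Hh.
  - intros x Hx; apply Hc; [exact (ordinal_mem _ _ Oa Hx)|].
    apply mem_succ; now left.
Qed.

End Least.

(** * Indiscernibles from the partition relation *)

(** The size of [x] codes the term to be evaluated at the increasing enumeration
    of [x], so that two colours take care of countably many terms. *)
Definition colouring (x : V) : V :=
  tv (exists m s, enumerates x m s /\ holds (eval (decode (fst (of_nat m))) s)).

Lemma increasing_enumerates H s m :
  increasing H s -> enumerates (initial_range s m) m s.
Proof.
  intros [Hs Is]; split; [|split].
  - intros n Hn; apply mem_initial_range; now exists n.
  - intros a b Hab _; now apply Is.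
  - intros y Hy; now apply mem_initial_range.
Qed.

Lemma initial_range_size H s m : increasing H s -> has_size m (initial_range s m).
Proof.
  intros [_ Is]; exists (map s (seq 0 m)); split; [|split].
  - apply Injective_map_NoDup; [|apply seq_NoDup]; intros a b E.
    destruct (Nat.lt_trichotomy a b) as [L|[L|L]]; [|exact L|];
      apply Is in L; rewrite E in L; now apply mem_irrefl in L.
  - now rewrite length_map, length_seq.
  - intros y; rewrite mem_initial_range, in_map_iff; split.
    + intros [n [Hn E]]; exists n; split; [exact E|]; apply in_seq; lia.
    + intros [n [E Hn]]; apply in_seq in Hn; exists n; split; [lia|exact E].
Qed.

Lemma colouring_eval H s t N : increasing H s ->
  (forall e e', (forall n, n < N -> e n = e' n) -> eval t e = eval t e') ->
  colouring (initial_range s (to_nat (code t, N))) = tv (holds (eval t s)).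
Proof.
  intros Is HN; set (m := to_nat (code t, N)).
  assert (Em : decode (fst (of_nat m)) = t).
  { unfold m; rewrite cancel_of_to; apply decode_code. }
  assert (Lm : N <= m).
  { assert (K := to_nat_non_decreasing (code t) N); unfold m; lia. }
  assert (Es := increasing_enumerates H s m Is).
  apply tv_ext; split.
  - intros [m' [s' [E' K]]].
    assert (A : m = m').
    { destruct (Nat.lt_trichotomy m m') as [L|[L|L]]; [|exact L|].
      - destruct (enumerates_agree _ _ _ _ _ E' Es m L); lia.
      - destruct (enumerates_agree _ _ _ _ _ Es E' m' L); lia. }
    subst m'; rewrite Em in K; rewrite (HN s s'); [exact K|].
    intros n Hn; apply (enumerates_agree _ _ _ _ _ Es E' n); lia.
  - intros K; exists m, s; split; [exact Es|]; now rewrite Em.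
Qed.

(** A term [t] with support [N] is handled by the sets of size
    [to_nat (code t, N)], which have at least [N] members. *)
Lemma arrow_good w : is_omega1 w -> numeral 2 ∈ kappa -> arrow_finite kappa w ->
  exists H, good H.
Proof.
  intros [Ow [Uw Cw]] H2 Ar.
  destruct (Ar _ H2 colouring (fun n x _ => tv_two _)) as [X [Xk [[g [g1 [g2 g3]]] Hom]]].
  assert (grefl : forall x y, x ∈ w -> y ∈ w -> g x ∈ g y -> x ∈ y).
  { intros x y Hx Hy K.
    destruct (proj2 Ow x y Hx Hy) as [L|[->|L]]; [exact L| |].
    - now apply mem_irrefl in K.
    - apply g2 in L; auto; now apply mem_asym in L. }
  exists (fun x => x ∈ X); constructor.
  - exact Xk.
  - intros [f If]; apply Uw, injects_omega_countable.
    exists (fun x => f (g x)); intros x y Hx Hy E; apply If in E; auto.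
    destruct (proj2 Ow x y Hx Hy) as [L|[L|L]]; [|exact L|];
      apply g2 in L; auto; rewrite E in L; now apply mem_irrefl in L.
  - intros x Hx; destruct (g3 x Hx) as [a [Ha <-]].
    apply (countable_image (fun b => b ∈ a) _ g).
    + now apply injects_omega_countable, Cw.
    + intros y [Hy K]; destruct (g3 y Hy) as [b [Hb <-]].
      exists b; split; [now apply grefl | reflexivity].
  - intros f [t Ht] s s' Is Is'; rewrite <- !Ht.
    destruct (eval_support t) as [N HN].
    assert (Sub : forall s, increasing (fun x => x ∈ X) s ->
      subset_of_size (to_nat (code t, N)) X (initial_range s (to_nat (code t, N)))).
    { intros u Iu; split; [|exact (initial_range_size _ u _ Iu)].
      intros z Hz; apply mem_initial_range in Hz; destruct Hz as [n [_ <-]].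
      apply Iu. }
    assert (E := Hom _ _ _ (Sub s Is) (Sub s' Is')).
    rewrite (colouring_eval _ s t N Is HN), (colouring_eval _ s' t N Is' HN) in E.
    rewrite <- (holds_tv (holds (eval t s))), E; apply holds_tv.
Qed.

End Definability.

(** * The symbols of the language *)

Definition extendible_to (k S alpha : V) : Prop :=
  exists M h, end_elementary_extension (R_structure k S) M /\
    well_founded_structure M /\ ordinal_height M h /\ alpha ⊆ h.

Definition unbounded_map (k a : V) (f : V -> V) : Prop :=
  a ∈ k /\ (forall x, x ∈ a -> f x ∈ k) /\
  forall b, b ∈ k -> exists x, x ∈ a /\ ~ f x ∈ b.

Definition short_domain (k : V) : V :=
  if excluded_middle_informative (regular k) then k
  else epsilon (inhabits empty) (fun a => exists f, unbounded_map k a f).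

Definition large_power (k : V) : V :=
  if excluded_middle_informative (strong_limit k) then k
  else epsilon (inhabits empty) (fun a => a ∈ k /\
    forall b, b ∈ k -> ~ equinumerous (power a) b).

(** The cases follow the numbering of the symbols, the last one being
    [sym_pred]. *)
Definition witnesses (n : nat) (k x : V) : V :=
  match n with
  | 0 => short_domain k
  | 1 => epsilon (inhabits (fun y => y)) (unbounded_map k (short_domain k)) x
  | 2 => large_power k
  | 3 => epsilon (inhabits (fun y => y))
      (fun E => exists t, well_orders E t (power k)) x
  | 4 => omega
  | _ => epsilon (inhabits empty) (fun S => S ⊆ R k /\
      exists alpha, ordinal alpha /\ ~ extendible_to k S alpha)
  end.

Lemma not_regular_witness k : ~ regular k ->
  unbounded_map k (witnesses sym_domain k k) (witnesses sym_map k).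
Proof.
  intros N.
  assert (Ex : exists a f, unbounded_map k a f).
  { apply NNPP; intros K; apply N; intros a f Ha Hf; apply NNPP; intros K'.
    apply K; exists a, f; split; [exact Ha|]; split; [exact Hf|].
    intros b Hb; apply NNPP; intros K2; apply K'; exists b; split; [exact Hb|].
    intros x Hx; apply NNPP; intros K3; apply K2; now exists x. }
  apply (epsilon_spec (inhabits empty)) in Ex.
  change (witnesses sym_domain k k) with (short_domain k).
  assert (Ea : short_domain k = epsilon (inhabits empty)
    (fun a => exists f, unbounded_map k a f)).
  { unfold short_domain; destruct (excluded_middle_informative (regular k));
      [contradiction | reflexivity]. }
  rewrite <- Ea in Ex.
  exact (epsilon_spec (inhabits (fun y => y)) _ Ex).
Qed.

Lemma not_strong_limit_witness k : ~ strong_limit k -> witnesses sym_power k k ∈ k /\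
  forall b, b ∈ k -> ~ equinumerous (power (witnesses sym_power k k)) b.
Proof.
  intros N; change (witnesses sym_power k k) with (large_power k).
  unfold large_power.
  destruct (excluded_middle_informative (strong_limit k)); [contradiction|].
  apply (epsilon_spec (inhabits empty)
    (fun a => a ∈ k /\ forall b, b ∈ k -> ~ equinumerous (power a) b)).
  apply NNPP; intros K; apply N; intros a Ha; apply NNPP; intros K'.
  apply K; exists a; split; [exact Ha|]; intros b Hb E; apply K'; now exists b.
Qed.

Theorem theorem3p5 (kappa omega1 : V) (homega1 : is_omega1 omega1)
  (hwc : weakly_compact kappa) (harrow : arrow_finite kappa omega1) :
  exists lambda : V, first_unfoldable lambda /\ lambda ∈ kappa.
Proof.
  destruct hwc as [[[Ok _] Hw] _].
  assert (H2 : numeral 2 ∈ kappa).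
  { apply (ordinal_trans kappa _ omega Ok); [|exact Hw].
    apply mem_omega; now exists 2. }
  destruct (arrow_good witnesses kappa omega1 homega1 H2 harrow) as [H0 G0].
  destruct (uncountable_inhabited H0 (good_uncountable _ _ _ G0)) as [l0 L0].
  destruct (mem_minimal (fun x => exists H, good witnesses kappa H /\ H x) l0)
    as [lam [[H [G Hlam]] Min]]; [now exists H0|].
  assert (Hmin : forall H', good witnesses kappa H' ->
    forall x, H' x -> ~ x ∈ lam).
  { intros H' G' x Hx Lx; apply (Min x Lx); now exists H'. }
  assert (Lk : lam ∈ kappa) by exact (good_sub _ _ _ G lam Hlam).
  assert (Ol := ordinal_mem _ _ Ok Lk).
  assert (Lw : omega ∈ lam)
    by exact (lam_above_omega witnesses kappa Ok H lam G Hlam (fun _ _ => eq_refl)).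
  assert (Reg : regular lam).
  { apply (lam_regular witnesses kappa Ok H lam G Hlam Hmin).
    - intros k Rk; change (witnesses sym_domain k k) with (short_domain k).
      unfold short_domain.
      destruct (excluded_middle_informative (regular k)); tauto.
    - exact not_regular_witness. }
  assert (SL : strong_limit lam).
  { apply (lam_strong_limit witnesses kappa Ok H lam G Hlam Hmin).
    - intros k Sk; change (witnesses sym_power k k) with (large_power k).
      unfold large_power.
      destruct (excluded_middle_informative (strong_limit k)); tauto.
    - exact not_strong_limit_witness.
    - intros a; exact (epsilon_spec (inhabits (fun y => y))
        (fun E => exists t, well_orders E t (power a)) (well_ordering (power a))). }
  assert (Unf : unfoldable lam).
  { split.
    - split; [split; [exact (regular_cardinal lam Ol Reg) | exact Lw]|].
      now split.
    - intros alpha S Oa HS; apply NNPP; intros N.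
      destruct (epsilon_spec (inhabits empty) (fun S => S ⊆ R lam /\
        exists alpha, ordinal alpha /\ ~ extendible_to lam S alpha))
        as [_ [a [Oa' Na]]].
      { exists S; split; [exact HS|]; now exists alpha. }
      apply Na.
      exact (arbitrarily_high_extensions witnesses kappa Ok H lam G Hlam Hmin
        a Lw Oa'). }
  destruct (mem_minimal (fun x => unfoldable x /\ x ∈ kappa) lam (conj Unf Lk))
    as [l [[Ul Kl] Ml]].
  exists l; split; [|exact Kl]; split; [exact Ul|]; intros y Hy Uy.
  apply (Ml y Hy); split; [exact Uy|]; exact (ordinal_trans _ _ _ Ok Hy Kl).
Qed.
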